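(* Let $m\ge 4$ and $d\ge 9$ be integers, let $r=\binom{m+d}{m}-1$, and let $P\in \mathbb{P}^r$ be a point with border rank $b_{m,d}(P)=5$. Assume that there is no $3$-dimensional linear subspace $H\subset \mathbb{P}^m$ such that $P\in \langle \nu_d(H)\rangle$. Then: (i) if $P$ has type $(1;5)$, then $r_{m,d}(P)=4d-3$; (ii) if $P$ has type $(2;3,2)$, then $r_{m,d}(P)=3d-1$; (iii) if $P$ has type $(2;4,1)$, then $r_{m,d}(P)=3d-1$; (iv) if $P$ has type $(3;3,1,1)$, then $r_{m,d}(P)=2d+1$; (v) if $P$ has type $(3;2,2,1)$, then $r_{m,d}(P)=2d+1$; (vi) if $P$ has type $(4;2,1,1,1)$, then $r_{m,d}(P)=d+3$; (vii) if $P$ has type $(5;1,1,1,1,1)$, then $r_{m,d}(P)=5$.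
   Context: Work over an algebraically closed field $\mathbb{K}$ of characteristic $0$ (e.g. $\mathbb{C}$). $\nu_d:\mathbb{P}^m\to\mathbb{P}^r$, $r=\binom{m+d}{m}-1$, is the degree $d$ Veronese embedding, $X_{m,d}=\nu_d(\mathbb{P}^m)$, and $\langle\ \rangle$ denotes linear span (of a set or of a closed subscheme, i.e. the smallest linear subspace containing it). The (symmetric tensor) rank $r_{m,d}(P)$ of $P\in\mathbb{P}^r$ is the minimal cardinality of a finite set $S\subset \mathbb{P}^m$ such that $P\in\langle\nu_d(S)\rangle$. For $t\ge 1$, $\sigma_t(X_{m,d})$ is the Zariski closure in $\mathbb{P}^r$ of the union of all $\langle \nu_d(S)\rangle$ with $S\subset\mathbb{P}^m$ finite and $\sharp(S)\le t$; $\sigma_0(X_{m,d})=\emptyset$. The border rank $b_{m,d}(P)$ is the unique $b>0$ with $P\in\sigma_b(X_{m,d})\setminus\sigma_{b-1}(X_{m,d})$. The cactus rank $z_{m,d}(P)$ is the minimal degree of a zero-dimensional scheme $Z\subset\mathbb{P}^m$ with $P\in\langle\nu_d(Z)\rangle$; a zero-dimensional scheme $A$ evinces the cactus rank of $P$ if $\deg(A)=z_{m,d}(P)$ and $P\in\langle\nu_d(A)\rangle$. Type: if $d\ge 9$ and $P$ has border rank $5$ and lies in no $\langle\nu_d(H)\rangle$ with $H\subset\mathbb{P}^m$ a $3$-dimensional linear subspace, then $z_{m,d}(P)=5$ and there is a unique zero-dimensional scheme $A\subset\mathbb{P}^m$ (of degree $5$) evincing the cactus rank of $P$ (known fact). If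 $A=A_1\sqcup\cdots\sqcup A_s$ is the decomposition of $A$ into connected components, ordered so that $b_i:=\deg(A_i)$ satisfies $b_1\ge\cdots\ge b_s$ (so $b_1+\cdots+b_s=5$), then $P$ (and $A$) is said to have type $(s;b_1,\dots,b_s)$. *)

(* Defs.v *)
From HB Require Import structures.
From mathcomp Require Import all_boot all_order all_algebra.
From mathcomp Require Export finmap.
From mathcomp Require Export mpoly.
Set Implicit Arguments.
Unset Strict Implicit.
Unset Printing Implicit Defensive.
Import GRing.Theory.
Local Open Scope ring_scope.

(** Points of [P^n] are the lines of [K^(n+1)]. *)
Record pspace (K : fieldType) (n : nat) := PPoint {
  pline : {vspace 'rV[K]_n.+1};
  pline_dim : \dim pline == 1%N }.

HB.instance Definition _ (K : fieldType) (n : nat) :=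
  [isSub of pspace K n for @pline K n].
HB.instance Definition _ (K : fieldType) (n : nat) :=
  [Choice of pspace K n by <:].

Section Projective.
Variables (K : fieldType) (n : nat).
Implicit Types (F : {mpoly K[n.+1]}) (U C : pspace K n -> Prop).

Definition vanishes_at F (p : pspace K n) : Prop :=
  forall v : 'rV[K]_n.+1, v \in pline p -> F.@[v 0] = 0.

Definition zariski_closed C : Prop :=
  exists2 J : {mpoly K[n.+1]} -> Prop,
    forall F, J F -> exists e, F \is e.-homog
  & forall p, C p <-> (forall F, J F -> vanishes_at F p).

Definition zariski_closure U (p : pspace K n) : Prop :=
  forall C, zariski_closed C -> (forall q, U q -> C q) -> C p.

(** [in_span U p] : [p] lies in the smallest linear subspace containing [U];
    the linear subspaces of [P^n] are the [P(W)], where [W = 0] is the empty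
    one and [dim P(W) = \dim W - 1]. *)
Definition in_span U (p : pspace K n) : Prop :=
  forall W : {vspace 'rV[K]_n.+1},
    (forall q, U q -> (pline q <= W)%VS) -> (pline p <= W)%VS.

(** Closed subschemes of [P^n] correspond bijectively to saturated homogeneous
    ideals of [K[x_0, ..., x_n]]; the empty scheme is the unit ideal. *)
Record subscheme := Subscheme {
  sideal : {mpoly K[n.+1]} -> Prop;
  sideal0 : sideal 0;
  sidealD : forall f g, sideal f -> sideal g -> sideal (f + g);
  sidealM : forall f g, sideal g -> sideal (f * g);
  sideal_homog : forall f, sideal f -> forall e, sideal (pihomog mdeg e f);
  sideal_sat : forall f k,
    (forall mon : 'X_{1..n.+1}, mdeg mon = k -> sideal ('X_[mon] * f)) ->
    sideal f }.

Implicit Types (Z : subscheme).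

Definition supp Z (p : pspace K n) : Prop :=
  forall f, sideal Z f -> vanishes_at f p.

(** Graph of the Hilbert function [e |-> dim_K (K[x]_e / I_e)]. *)
Definition hilbert_fun Z (e k : nat) : Prop :=
  exists I_e : {vspace dhomog n.+1 K e},
    (forall f : dhomog n.+1 K e,
       f \in I_e <-> sideal Z (mpoly_of_dhomog f)) /\
    (\dim I_e + k = \dim {:dhomog n.+1 K e})%N.

(** Dimension zero means that the Hilbert polynomial is a nonzero constant,
    and this constant is the degree. *)
Definition zero_dim_of_degree Z (k : nat) : Prop :=
  (0 < k)%N /\ exists e0, forall e, (e0 <= e)%N -> hilbert_fun Z e k.

Definition connected Z : Prop :=
  (exists p, supp Z p) /\
  forall C1 C2, zariski_closed C1 -> zariski_closed C2 ->
    (forall p, supp Z p -> C1 p \/ C2 p) ->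
    (forall p, supp Z p -> ~ (C1 p /\ C2 p)) ->
    (forall p, supp Z p -> C1 p) \/ (forall p, supp Z p -> C2 p).

(** The ideal of a scheme-theoretic union is the intersection of the ideals;
    as the supports are disjoint, this is [A = A_1 |_| ... |_| A_s]. *)
Definition connected_components (A : subscheme) (s : nat)
    (A_ : 'I_s -> subscheme) : Prop :=
  [/\ forall i, connected (A_ i),
      forall i j, i != j -> forall p, ~ (supp (A_ i) p /\ supp (A_ j) p)
    & forall f, sideal A f <-> (forall i, sideal (A_ i) f)].

(** [A] has type [(s; b_1, ..., b_s)], with [b_1 >= ... >= b_s]. *)
Definition scheme_type (A : subscheme) (s : nat) (b : seq nat) : Prop :=
  [/\ size b = s, sorted geq b
    & exists2 A_ : 'I_s -> subscheme,
        connected_components A A_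
      & forall i, zero_dim_of_degree (A_ i) (nth 0%N b i)].

End Projective.

(** The dimension [r] of the ambient space of the Veronese embedding. *)
Definition vdim (m d : nat) : nat := ('C(m + d, m)).-1.

(** Enumeration of the monomials of degree [d] in [x_0, ..., x_m]. *)
Definition vmonomials (m d : nat) : seq 'X_{1..m.+1} :=
  [seq s2m t | t : d.-tuple 'I_m.+1 <- enum (basis m.+1 d)].

Definition vmon (m d : nat) (j : 'I_(vdim m d).+1) : 'X_{1..m.+1} :=
  nth 0%MM (vmonomials m d) j.

Lemma size_vmonomials m d : size (vmonomials m d) = (vdim m d).+1.
Proof.
rewrite /vmonomials size_basis /vdim prednK ?bin_gt0 ?leq_addr //.
by rewrite addnC -[RHS]bin_sub ?leq_addr // addKn.
Qed.

Section Veronese.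
Variables (K : fieldType) (m d : nat).
Local Notation r := (vdim m d).

Definition vvec (v : 'rV[K]_m.+1) : 'rV[K]_r.+1 :=
  \row_j \prod_(i < m.+1) v 0 i ^+ vmon j i.

Lemma vvec_neq0 v : v != 0 -> vvec v != 0.
Proof.
case/rV0Pn=> i vi0; apply/rV0Pn.
have mU : (U_(i) *+ d)%MM \in vmonomials m d.
  by rewrite /vmonomials -basis_cover mdegMn mdeg1 mul1n.
have lt_j : (index (U_(i) *+ d)%MM (vmonomials m d) < r.+1)%N.
  by rewrite -size_vmonomials index_mem.
exists (Ordinal lt_j); rewrite mxE /vmon /= nth_index //.
apply/prodf_neq0 => k _; rewrite mulmnE mnm1E.
by have [<-|_] := eqVneq i k; rewrite ?mul0n ?expr0 ?oner_neq0 ?expf_neq0.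
Qed.

Fact veronese_subproof (p : pspace K m) :
  \dim <[vvec (vpick (pline p))]>%VS == 1%N.
Proof.
rewrite dim_vline vvec_neq0 // vpick0 -dimv_eq0.
by rewrite (eqP (pline_dim p)).
Qed.

(** [nu_d]; [veronese_line] shows independence of the representative. *)
Definition veronese (p : pspace K m) : pspace K r :=
  PPoint (veronese_subproof p).

Lemma vvecZ c v : vvec (c *: v) = c ^+ d *: vvec v.
Proof.
apply/rowP=> j; rewrite !mxE.
under eq_bigr do rewrite mxE exprMn.
rewrite big_split /=; congr (_ * _).
rewrite -expr_sum -mdegE; congr (_ ^+ _); apply/eqP.
by rewrite basis_cover (mem_nth 0%MM) // size_vmonomials.
Qed.

Lemma veronese_line (p : pspace K m) v :
  v \in pline p -> v != 0 -> pline (veronese p) = <[vvec v]>%VS.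
Proof.
move=> vp v0 /=; set w := vpick _.
have : pline p = <[v]>%VS.
  apply/esym/eqP; rewrite eqEdim -memvE vp dim_vline v0.
  by rewrite (eqP (pline_dim p)).
move=> E; have : w \in <[v]>%VS by rewrite -E memv_pick.
have w0 : w != 0.
  by rewrite vpick0 -dimv_eq0 (eqP (pline_dim p)).
case/vlineP=> c Ew; rewrite Ew vvecZ.
have c0 : c != 0 by apply: contraNneq w0 => c0; rewrite Ew c0 scale0r.
apply/eqP; rewrite eqEdim -memvE memvZ ?memv_line //.
by rewrite !dim_vline scaler_eq0 expf_eq0 (negPf c0) andbF /= leqnn.
Qed.

Definition veronese_image (U : pspace K m -> Prop) (Q : pspace K r) : Prop :=
  exists2 p, U p & Q = veronese p.

Definition in_veronese_span (S : {fset pspace K m}) (P : pspace K r) : Prop :=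
  in_span (veronese_image (fun p => p \in S)) P.

Definition veronese_pullback (L : {mpoly K[r.+1]}) : {mpoly K[m.+1]} :=
  L \mPo [tuple 'X_[vmon j] | j < r.+1].

(** The linear subspace [P(W)] contains [nu_d(Z)] iff all the linear forms
    cutting it out pull back into the ideal of [Z]; the span of [nu_d(Z)] is
    the smallest such subspace. *)
Definition in_veronese_scheme_span (Z : subscheme K m) (P : pspace K r) :=
  forall W : {vspace 'rV[K]_r.+1},
    (forall L : {mpoly K[r.+1]}, L \is 1.-homog ->
       (forall w : 'rV[K]_r.+1, w \in W -> L.@[w 0] = 0) ->
       sideal Z (veronese_pullback L)) ->
    (pline P <= W)%VS.

Definition rank_is (P : pspace K r) (k : nat) : Prop :=
  (exists S : {fset pspace K m}, #|` S| = k /\ in_veronese_span S P) /\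
  (forall S : {fset pspace K m}, in_veronese_span S P -> (k <= #|` S|)%N).

Definition secant (t : nat) : pspace K r -> Prop :=
  zariski_closure (fun Q =>
    exists S : {fset pspace K m}, (#|` S| <= t)%N /\ in_veronese_span S Q).

Lemma secant0 P : ~ secant 0 P.
Proof.
apply; last first.
  move=> Q [S []]; rewrite leqn0 cardfs_eq0 => /eqP-> /(_ 0%VS) Q0.
  suff: (pline Q <= 0)%VS.
    by rewrite subv0 => /eqP EQ; have := pline_dim Q; rewrite EQ dimv0.
  by apply: Q0 => q [p]; rewrite inE.
exists (fun F => F = 1) => [_ ->|p]; first by exists 0%N; exact: dhomog1.
split=> // /(_ 1 erefl (vpick (pline p)) (memv_pick _)) /eqP.
by rewrite rmorph1 oner_eq0.
Qed.

Definition border_rank_is (P : pspace K r) (b : nat) : Prop :=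
  [/\ (0 < b)%N, secant b P & ~ secant b.-1 P].

Definition cactus_rank_is (P : pspace K r) (k : nat) : Prop :=
  (exists Z, zero_dim_of_degree Z k /\ in_veronese_scheme_span Z P) /\
  (forall Z k', zero_dim_of_degree Z k' -> in_veronese_scheme_span Z P ->
     (k <= k')%N).

Definition evinces_cactus_rank (A : subscheme K m) (P : pspace K r) : Prop :=
  in_veronese_scheme_span A P /\
  exists2 k, cactus_rank_is P k & zero_dim_of_degree A k.

(** Meant for points [P] whose cactus rank is evinced by a unique scheme [A]. *)
Definition has_type (P : pspace K r) (s : nat) (b : seq nat) : Prop :=
  exists2 A, evinces_cactus_rank A P & scheme_type A s b.

End Veronese.

(* Main.v *)
From HB Require Import structures.
From Stdlib Require Import Classical ClassicalEpsilon.
Require Import Defs.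
From mathcomp Require Import all_boot all_order all_algebra.
From mathcomp Require Import separable falgebra.
From mathcomp Require Import ring zify.
Set Implicit Arguments.
Unset Strict Implicit.
Unset Printing Implicit Defensive.
Import GRing.Theory.
Local Open Scope ring_scope.

(** The numbers in the seven cases are all [5 + (5 - s) (d - 2)], where [s] is
    the number of points in the support of the scheme [A] that evinces the
    cactus rank.  Write [T] for the polynomial ring and [I] for the ideal of
    [A].  A point [P] of the ambient space is a linear form [L] on the forms
    of degree [d] ([eval_at]); [P] lies in the span of [nu_d(A)] iff [L] kills
    [I] in degree [d], and in the span of [nu_d(S)] iff [L] kills the forms
    that vanish on [S] ([in_scheme_spanP], [in_spanP]).  As [P] is in no span
    of a [nu_d(H)], the linear forms in [I] have codimension 5, so that
    [T_e / I_e] has dimension 5 for all [e > 0]; and as no smaller scheme has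
    [P] in its span, [L] is nondegenerate: if [L] kills [a T_(d-1)] for
    a linear form [a], then [a] is in [I] ([minimal_nondegenerate]).

    The lower bound ([rank_lower_bound]) is a substitution argument in the
    manner of Alder and Strassen, by induction on the degree.  Let [P] be in
    the span of [nu_d(S)].  The linear forms vanishing on the support of [A]
    have dimension at least [5 - s] modulo [I], and by nondegeneracy those
    that vanish on [S] are in [I].  So a linear form that has no zero on the
    support can be corrected by one of them to a form [b] that vanishes at
    [5 - s] points of [S]; [b] is still invertible along [A].  The linear form
    [f |-> L (b f)] in degree one less is again nondegenerate, and it kills
    the forms that vanish at the points of [S] where [b] is not 0: each degree
    costs [5 - s] points.  In degree 2 nondegeneracy gives 5 points.

    For the upper bound, [L] is a sum of forms that kill the ideals of the
    connected components of [A], each supported at a single point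
    ([connected_point]); so a local scheme of length [n <= 5] must be shown to
    give rank at most [(n - 1) (d - 1) + 1] ([local_waring]).  Multiplication
    by quotients of linear forms is described by commuting matrices, and the
    quotient by the radical of [L] is a local Gorenstein algebra [V] with
    a form [psi] ([gen_gorenstein]).  If the maximal ideal [N] of [V] is
    principal, [V] embeds in a rational normal curve, and Sylvester's method
    gives the decomposition ([curvilinear_waring]).  Otherwise, a dimension
    count that uses [n <= 5] gives [y] in [N] with [y N^2 = 0] and
    [psi (y^2) != 0] ([principal_or_split]); then [V] is the sum of the line
    of [y] and of a smaller local Gorenstein algebra, and the new direction
    adds a binary form of type [x^(d-2) y^2], of rank [d - 1]
    ([waring_split]).

    The needed geometry of zero-dimensional schemes follows from a projective
    Nullstellensatz ([nullstellensatz]) proved by adjoining, for each variable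
    [x_i], one linear factor [x_i - z l] of a binary relation. *)

(** * Linear algebra and quadrature formulas *)

(** An anonymous linear function, as an element of the structure. *)
Definition mk_linear (K : fieldType) (U W : lmodType K) (f : U -> W)
    (lf : linear f) : {linear U -> W} :=
  HB.pack f (GRing.isLinear.Build K U W *:%R f lf).

Lemma dim_addv_line (K : fieldType) (vT : vectType K) (U : {vspace vT}) v :
  v \notin U -> \dim (U + <[v]>) = (\dim U).+1.
Proof.
move=> vU; have v0 : v != 0 by apply: contraNneq vU => ->; rewrite mem0v.
rewrite dimv_disjoint_sum ?dim_vline ?v0 ?addn1 //.
apply/eqP; rewrite -subv0; apply/subvP => w; rewrite memv_cap => /andP[wU /vlineP[a Ew]].
have [a0|a0] := eqVneq a 0; first by rewrite Ew a0 scale0r mem0v.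
by case/negP: vU; rewrite -[v](scalerK a0) -Ew memvZ.
Qed.

Lemma dim_cap_lker (K : fieldType) (vT : vectType K) (U : {vspace vT}) (f : 'Hom(vT, K^o)) :
  (\dim U <= (\dim (U :&: lker f)).+1)%N.
Proof.
rewrite -{1}(limg_ker_dim f U) -[X in (_ <= X)%N]addn1 leq_add2l.
by apply: leq_trans (dimvS (subvf _)) _; rewrite dimvf.
Qed.

Lemma large_summand n (F : 'I_n -> nat) k :
  (n * k < \sum_i F i)%N -> exists i, (k <= F i)%N.
Proof.
move=> lt; have /existsP[i le_i] : [exists i, (k <= F i)%N]; last by exists i.
apply: contraLR lt; rewrite negb_exists => /forallP Hlt.
rewrite -leqNgt -[X in (X * _)%N]card_ord -sum_nat_const leq_sum // => i _.
by rewrite ltnW // ltnNge.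
Qed.

Section Quadrature.
Variable K : fieldType.

Lemma vanish_mulX (L : {linear {poly K} -> K^o}) (g f : {poly K}) n :
  (forall k, (k < n)%N -> L (g * 'X^k) = 0) -> (size f <= n)%N -> L (g * f) = 0.
Proof.
move=> H sf; rewrite -[f]coefK poly_def mulr_sumr linear_sum big1 // => i _.
by rewrite -scalerAr linearZ /= H ?scaler0 // (leq_trans (ltn_ord i) sf).
Qed.

(** Sylvester's argument in dual form: as [L] kills the multiples of
    [g = \prod (X - z)], it only depends on the remainder modulo [g], which
    Lagrange interpolation writes through the values at the roots [z]. *)
Lemma quadrature (L : {linear {poly K} -> K^o}) (zs : seq K) D :
  uniq zs ->
  (forall k, (k + size zs <= D)%N -> L (\prod_(z <- zs) ('X - z%:P) * 'X^k) = 0) ->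
  exists c : K -> K, forall f : {poly K}, (size f <= D.+1)%N ->
    L f = \sum_(z <- zs) c z * f.[z].
Proof.
move=> Uz HL; set g := \prod_(z <- zs) _ in HL.
have gm : g \is monic by exact: monic_prod_XsubC.
have sg : size g = (size zs).+1 by rewrite size_prod_XsubC.
pose l z := \prod_(y <- rem z zs) ('X - y%:P).
exists (fun z => L (l z) / (l z).[z]) => f sf.
have lz0 z : (l z).[z] != 0.
  rewrite horner_prod prodf_seq_neq0; apply/allP => y /=.
  by rewrite mem_rem_uniq // inE hornerXsubC subr_eq0 eq_sym => /andP[].
have gl z : z \in zs -> g = ('X - z%:P) * l z.
  by move=> zz; rewrite /g (big_rem z zz).
have Lg (q : {poly K}) : (size q <= D.+1 - size zs)%N -> L (g * q) = 0.
  by move=> ?; apply: (@vanish_mulX _ _ _ (D.+1 - size zs)) => // k Hk; apply: HL; lia.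
have Er : f %% g = \sum_(z <- zs) (f.[z] / (l z).[z]) *: l z.
  apply/eqP; rewrite -subr_eq0; apply/eqP.
  apply: (@roots_geq_poly_eq0 _ _ zs) => //.
    apply/allP => z zz; rewrite rootE hornerD hornerN horner_sum.
    rewrite (bigD1_seq z) //= big1_seq ?addr0 => [|y /andP[yz yzs]]; last first.
      rewrite hornerZ [(l y).[z]](_ : _ = 0) ?mulr0 //.
      apply/eqP; rewrite horner_prod prodf_seq_eq0; apply/hasP; exists z => /=.
        by rewrite mem_rem_uniq // inE eq_sym yz.
      by rewrite hornerXsubC subrr.
    rewrite hornerZ divfK // {2}(divp_eq f g) hornerD hornerM.
    by rewrite (gl z) // hornerM hornerXsubC subrr mul0r mulr0 add0r subrr.
  rewrite -ltnS -sg; apply: leq_ltn_trans (size_polyD _ _) _.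
  rewrite gtn_max size_polyN ltn_modpN0 ?monic_neq0 //= sg ltnS.
  apply: leq_trans (size_sum _ _ _) _; apply/bigmax_leqP_seq => z zz _.
  apply: leq_trans (size_scale_leq _ _) _; rewrite size_prod_XsubC size_rem //.
  by case: (zs) zz.
rewrite {1}(divp_eq f g) linearD [X in X + _](_ : _ = 0) ?add0r; last first.
  by rewrite mulrC; apply: Lg; rewrite size_divp ?monic_neq0 // sg leq_sub2r.
rewrite Er linear_sum; apply: eq_bigr => z _; rewrite linearZ /= /GRing.scale /=.
by rewrite mulrC mulrA mulrAC.
Qed.

End Quadrature.

Section Closed.
Variable K : closedFieldType.
Hypothesis charK0 : [pchar K] =i pred0.

Lemma natr_neq0 n : (n.+1)%:R != 0 :> K.
Proof. by rewrite ((pcharf0P K).1 charK0). Qed.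

(** In characteristic 0 the natural numbers are infinitely many elements. *)
Lemma exists_notin (s : seq K) : exists x, x \notin s.
Proof.
pose t := [seq n%:R : K | n <- iota 0 (size s).+1].
have Ut : uniq t.
  rewrite map_inj_in_uniq ?iota_uniq // => i j _ _ /eqP.
  wlog le_ij : i j / (i <= j)%N.
    by move=> H; case/orP: (leq_total i j) => [/H // | /H hij]; rewrite eq_sym => /hij.
  rewrite eq_sym -subr_eq0 -natrB //; case E: (j - i)%N => [|k].
    by move=> _; lia.
  by rewrite (negPf (natr_neq0 k)).
have : has (fun x => x \notin s) t.
  apply/negPn/negP => /hasPn H.
  have /(uniq_leq_size Ut) : {subset t <= s} by move=> x /H; rewrite negbK.
  by rewrite size_map size_iota ltnn.
by case/hasP=> x _ ?; exists x.
Qed.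

Lemma simple_roots_split (p : {poly K}) :
  p != 0 -> (forall z, root p z -> ~~ root p^`() z) ->
  exists2 zs, uniq zs & p = lead_coef p *: \prod_(z <- zs) ('X - z%:P).
Proof.
move=> p0 H; have [zs Ez] := closed_field_poly_normal p; exists zs => //.
rewrite -separable_prod_XsubC.
have lc0 : lead_coef p != 0 by rewrite lead_coef_eq0.
have -> : separable_poly (\prod_(z <- zs) ('X - z%:P)) = separable_poly p.
  by apply: eqp_separable; rewrite [X in _ %= X]Ez eqp_sym eqp_scale.
by rewrite unlock; apply/Pdiv.ClosedField.coprimepP=> z /H.
Qed.

Lemma quadrature_closed (L : {linear {poly K} -> K^o}) (g : {poly K}) D q :
  size g = q.+1 -> (forall z, root g z -> ~~ root g^`() z) ->
  (forall k, (k + q <= D)%N -> L (g * 'X^k) = 0) ->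
  exists cz : seq (K * K), (size cz <= q)%N /\ forall f : {poly K}, (size f <= D.+1)%N ->
    L f = \sum_(a <- cz) a.1 * f.[a.2].
Proof.
move=> sg sr HL; have g0 : g != 0 by rewrite -size_poly_eq0 sg.
have lc0 : lead_coef g != 0 by rewrite lead_coef_eq0.
have [zs Uz Eg] := simple_roots_split g0 sr.
have szs : size zs = q.
  by move: sg; rewrite Eg size_scale // size_prod_XsubC => -[].
have [k Hk|c Hc] := @quadrature K L zs D Uz.
  apply: (mulfI lc0); rewrite mulr0 -[_ * _]linearZ /= scalerAl -Eg.
  by apply: HL; rewrite -szs.
exists [seq (c z, z) | z <- zs]; rewrite size_map szs; split=> // f /Hc ->.
by rewrite big_map.
Qed.

(** The node polynomial is [X^(d-1) - 1], the apolar form of [x^(d-2) y^2]: its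
    coefficients of degree 1 and 2 vanish as [d - 1 >= 3]. *)
Lemma quadrature_coef2 d : (4 <= d)%N ->
  exists cz : seq (K * K), (size cz <= d.-1)%N /\ forall f : {poly K}, (size f <= d.+1)%N ->
    f`_2 = \sum_(a <- cz) a.1 * f.[a.2].
Proof.
move=> hd; pose L : {linear {poly K} -> K^o} := coefp 2.
have d1 : (0 < d.-1)%N by lia.
have [| z || cz [scz Hcz]] := @quadrature_closed L ('X^(d.-1) - 1) d d.-1.
- by rewrite size_XnsubC.
- rewrite !rootE derivB derivXn derivC subr0 !hornerE hornerMn !hornerXn .
  rewrite ?subr_eq0 => /eqP Ez; rewrite -mulr_natr mulf_neq0 //; last first.
    by case: (d.-1) d1 => // k _; apply: natr_neq0.
  apply/expf_neq0/eqP => z0; move: Ez; rewrite z0 expr0n -[d.-1]prednK //=.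
  by move/eqP; rewrite eq_sym oner_eq0.
- move=> k hk; rewrite /L /= mulrBl mul1r -exprD coefB !coefXn.
  have [-> ->] : (2 == d.-1 + k)%N = false /\ (2 == k)%N = false by split; apply/eqP; lia.
  by rewrite subr0.
by exists cz; split=> // f /Hcz.
Qed.

(** A multiple root [z] of [g + c X^q] satisfies [q g(z) = z g'(z)], an equation
    without [c] and with finitely many solutions; and each [z] determines [c]. *)
Lemma perturb_simple_roots (g : {poly K}) q :
  g.[0] != 0 -> (size g <= q)%N ->
  exists2 c : K, c != 0 & forall z, root (g + c *: 'X^q) z -> ~~ root (g + c *: 'X^q)^`() z.
Proof.
move=> g0 sg; pose H := q%:R *: g - 'X * g^`().
have q0 : (0 < q)%N.
  by rewrite lt0n; apply: contraNneq g0 => q0; move: sg;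
   rewrite q0 leqn0 size_poly_eq0 => /eqP->; rewrite horner0.
have qn0 : q%:R != 0 :> K by case: q q0 {sg H} => // k _; apply: natr_neq0.
have H0 : H != 0.
  apply: contraNneq g0 => H0; have : H.[0] = 0 by rewrite H0 horner0.
  rewrite hornerD hornerN hornerM hornerX mul0r subr0 hornerZ => /eqP.
  by rewrite mulf_eq0 (negPf qn0).
have [zs Ez] := closed_field_poly_normal H.
have [c Hc] := exists_notin (0 :: [seq - g.[z] / z ^+ q | z <- zs]).
move: Hc; rewrite inE negb_or => /andP[c0 Hc]; exists c => // z.
rewrite !rootE hornerD hornerZ hornerXn => /eqP rz; apply/negP.
rewrite derivD derivZ derivXn hornerD hornerZ hornerMn hornerXn => /eqP rz'.
have z0 : z != 0.
  by apply: contraNneq g0 => z0; move: rz; rewrite z0 expr0n (gtn_eqF q0) mulr0 addr0 => ->.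
case/negP: Hc; apply/mapP; exists z; last first.
  by apply/eqP; rewrite -(can2_eq (mulfK _) (divfK _)) ?expf_neq0 // -addr_eq0 addrC rz.
have lc : lead_coef H != 0 by rewrite lead_coef_eq0.
suff : root H z by rewrite Ez rootZ // root_prod_XsubC.
rewrite rootE hornerD hornerN hornerM hornerX hornerZ.
have -> : g^`().[z] = - (c * (z ^+ q.-1 *+ q)) by apply/eqP; rewrite -addr_eq0 rz'.
have -> : g.[z] = - (c * z ^+ q) by apply/eqP; rewrite -addr_eq0 rz.
rewrite !mulrN opprK !mulrnAr [z * (c * _)]mulrCA -exprS prednK //.
by rewrite mulr_natl addNr.
Qed.

End Closed.

(** * Waring decompositions of local Gorenstein algebras *)

Section Orth.
Variables (K : fieldType) (R : falgType K) (psi : 'Hom(R, K^o)).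

(** The elements of [V] orthogonal to [U] for the form [psi (v w)]. *)
Definition orthv (V U : {vspace R}) : {vspace R} :=
  (V :&: \bigcap_(u <- vbasis U) lker (psi \o amulr u)%VF)%VS.

Lemma mem_orthv (V U : {vspace R}) v :
  reflect (v \in V /\ forall u, u \in U -> psi (v * u) = 0) (v \in orthv V U).
Proof.
have E (s : seq R) : reflect (forall u, u \in s -> psi (v * u) = 0)
    (v \in \bigcap_(u <- s) lker (psi \o amulr u))%VS.
  elim: s => [|a s IH]; first by rewrite big_nil memvf; constructor.
  rewrite big_cons memv_cap memv_ker comp_lfunE !lfunE /=.
  apply: (iffP andP) => [[/eqP Ha /IH H] u|H].
    by rewrite inE => /predU1P[->//|/H].
  split; first by rewrite H ?mem_head.
  by apply/IH => u us; apply: H; rewrite inE us orbT.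
rewrite memv_cap; apply: (iffP andP) => -[vV].
  move/E => H; split=> // u uU; rewrite (coord_vbasis uU) mulr_sumr linear_sum big1 // => i _.
  by rewrite -scalerAr linearZ /= H ?scaler0 ?mem_nth ?size_tuple.
by move=> H; split=> //; apply/E => u /vbasis_mem/H.
Qed.

Lemma dim_orthv (V U : {vspace R}) : (\dim V <= \dim (orthv V U) + \dim U)%N.
Proof.
rewrite /orthv -[X in (_ + X)%N](size_tuple (vbasis U)); elim: (tval (vbasis U)) => [|a s IH].
  by rewrite big_nil capvf addn0.
rewrite big_cons /= [(lker _ :&: _)%VS]capvC capvA addnS -addSn; apply: leq_trans IH _.
by rewrite leq_add2r dim_cap_lker.
Qed.

(** A complement [C] of the orthogonal of [U] has no nonzero orthogonal element
    in [U]: such an element would be orthogonal to [V]. *)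
Lemma dim_orthv_nondeg (V U : {vspace R}) :
  {in V &, commutative *%R} -> (U <= V)%VS ->
  (forall v, v \in V -> (forall w, w \in V -> psi (v * w) = 0) -> v = 0) ->
  (\dim (orthv V U) + \dim U <= \dim V)%N.
Proof.
move=> cV UV nd; pose W := orthv V U; pose C := (V :\: W)%VS.
have WV : (W <= V)%VS by apply: capvSl.
have dC : (\dim C + \dim W = \dim V)%N.
  by rewrite -(dimv_cap_compl V W) addnC (capv_idPr WV).
rewrite -dC addnC leq_add2r.
have := dim_orthv U C; suff -> : orthv U C = 0%VS by rewrite dimv0.
apply/eqP; rewrite -subv0; apply/subvP => u /mem_orthv[uU Hu]; rewrite memv0.
have uV := subvP UV _ uU.
apply/eqP/nd => // w; rewrite -(addv_diff_cap V W).
case/memv_addP => c cC [w' ]; rewrite memv_cap => /andP[w'V w'W] ->.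
rewrite mulrDr linearD /= Hu // add0r cV //.
by case/mem_orthv: w'W => _ ->.
Qed.

End Orth.

Lemma size_prod_le (K : fieldType) (T : eqType) (F : T -> {poly K}) (s : seq T) k :
  (forall y, y \in s -> (size (F y) <= k.+1)%N) ->
  (size (\prod_(y <- s) F y)%R <= (k * size s).+1)%N.
Proof.
elim: s => [|y s IH] H; first by rewrite big_nil size_poly1.
rewrite big_cons; apply: leq_trans (size_polyMleq _ _) _.
have := H y (mem_head _ _); have : (size (\prod_(z <- s) F z)%R <= (k * size s).+1)%N.
  by apply: IH => z zs; apply: H; rewrite inE zs orbT.
by rewrite /=; lia.
Qed.

Section Waring.
Variables (K : closedFieldType) (charK0 : [pchar K] =i pred0) (d : nat) (hd : (4 <= d)%N).
Variable R : falgType K.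

(** [psi (x_1 ... x_d)] is a combination of [r] products of values of linear
    forms: the polarized statement that [psi (x^d)] has Waring rank at most
    [r] on [V]. *)
Definition waring_le (V : {vspace R}) (psi : 'Hom(R, K^o)) r :=
  exists cu : seq (K * 'Hom(R, K^o)), (size cu <= r)%N /\
    forall s : seq R, size s = d -> {subset s <= V} ->
      psi (\prod_(x <- s) x) = \sum_(a <- cu) a.1 * \prod_(x <- s) (a.2 x : K).

(** [V] is a commutative local algebra with residue field [K] and maximal ideal
    [N], and the bilinear form [psi (v w)] is nondegenerate on it.  [V] is kept
    as a subspace of a fixed algebra so that the induction can pass to
    subalgebras. *)
Definition local_gorenstein (V N : {vspace R}) (psi : 'Hom(R, K^o)) :=
  [/\ {in V &, commutative *%R}, (N <= V)%VS /\ V = (<[1]> + N)%VS,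
      (N * N <= N)%VS, (exists k, N ^+ k.+1 = 0)%VS &
      forall v, v \in V -> (forall w, w \in V -> psi (v * w) = 0) -> v = 0].

Section LocalTheory.
Variables (V N : {vspace R}) (psi : 'Hom(R, K^o)).
Hypothesis G : local_gorenstein V N psi.
Let n := \dim V.

Lemma local_one_mem : 1 \in V.
Proof. by case: G => _ [_ ->] *; rewrite memvE addvSl. Qed.

Lemma local_decomp v : v \in V -> exists c a, a \in N /\ v = c%:A + a.
Proof.
case: G => _ [_ ->] _ _ _ /memv_addP[u /vlineP[c ->]] [a aN ->].
by exists c, a.
Qed.

Lemma one_notin_nil : 1 \notin N.
Proof.
case: G => _ _ _ [k Nk] _; apply/negP => N1; move: (oner_neq0 R).
rewrite -memv0 -Nk; suff -> : 1 \in (N ^+ k.+1)%VS by [].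
elim: k {Nk} => [|k IH]; first by rewrite expv1.
by rewrite expvSl -{1}[1]mulr1 memv_mul.
Qed.

Lemma dim_local : n = (\dim N).+1.
Proof.
by case: G => _ [_ EV] _ _ _; rewrite /n EV addvC dim_addv_line // one_notin_nil.
Qed.

Lemma expv_nil_sub k : (N ^+ k.+2 <= N ^+ k.+1)%VS.
Proof.
case: G => _ _ NN _ _; elim: k => [|k IH]; first by rewrite expv2 expv1.
by rewrite expvSl [X in (_ <= X)%VS]expvSl prodvSr.
Qed.

(** The powers of [N] decrease strictly until they are 0: if two consecutive
    powers agree, all the later ones do. *)
Lemma dim_expv_nil k : (\dim (N ^+ k.+1) <= n - k.+1)%N.
Proof.
elim: k => [|k IH]; first by rewrite expv1 dim_local subSS subn0.
have [E|ne] := eqVneq (N ^+ k.+2)%VS (N ^+ k.+1)%VS.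
  have Ej j : (N ^+ (k.+1 + j) = N ^+ k.+1)%VS.
    elim: j => [|j IHj]; first by rewrite addn0.
    by rewrite addnS expvSl IHj -expvSl.
  case: G => _ _ _ [j Nj] _; rewrite E -(Ej j.+1) expvD Nj prodv0 dimv0 //.
have : (\dim (N ^+ k.+2) < \dim (N ^+ k.+1))%N.
  by rewrite ltn_neqAle dimvS ?expv_nil_sub // andbT dimv_leqif_eq ?expv_nil_sub.
lia.
Qed.

Lemma expv_nil_eq0 : (N ^+ n = 0)%VS.
Proof.
apply/eqP; rewrite -dimv_eq0 -leqn0.
have := dim_expv_nil n.-1; rewrite dim_local /=; lia.
Qed.

End LocalTheory.

Section Curvilinear.
Variables (V N : {vspace R}) (psi : 'Hom(R, K^o)) (x : R).
Hypothesis G : local_gorenstein V N psi.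
Hypothesis Nx : (N <= <[x]> + N * N)%VS.
Hypothesis xN : x \in N.
Let n := \dim V.
Let X := [tuple x ^+ i | i < n].

Lemma nth_powers (i : 'I_n) : X`_i = x ^+ i.
Proof. by rewrite -tnth_nth tnth_mktuple. Qed.

Lemma power_mem_expv k : x ^+ k.+1 \in (N ^+ k.+1)%VS.
Proof.
elim: k => [|k IH]; first by rewrite expr1 expv1.
by rewrite exprS expvSl memv_mul.
Qed.

Lemma power_eq0 k : (n <= k)%N -> x ^+ k = 0.
Proof.
move=> le_nk; rewrite -(subnKC le_nk) exprD.
have n0 : (0 < n)%N by rewrite /n (dim_local G).
have -> : x ^+ n = 0.
  by apply/eqP; rewrite -memv0 -(expv_nil_eq0 G) -/n -(prednK n0) power_mem_expv.
by rewrite mul0r.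
Qed.

(** Modulo [N^(k+2)], the power [N^(k+1)] is spanned by [x^(k+1)]; a descending
    induction on the exponent concludes. *)
Lemma powers_span : (V <= <<X>>)%VS.
Proof.
have xX i : x ^+ i \in <<X>>%VS.
  have [lt|le] := ltnP i n; last by rewrite power_eq0 // mem0v.
  by apply: memv_span; apply/mapP; exists (Ordinal lt); rewrite ?mem_enum.
have step k : (N ^+ k.+1 <= <[x ^+ k.+1]> + N ^+ k.+2)%VS.
  elim: k => [|k IH]; first by rewrite expr1 expv1 expv2.
  rewrite [X in (X <= _)%VS]expvSl; apply: subv_trans (prodvS Nx IH) _.
  have E3 : (N * N * N ^+ k.+1 = N ^+ k.+3)%VS by rewrite -prodvA -!expvSl.
  rewrite prodvDl !prodvDr prodv_line -exprS -!addvA addvS //.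
  rewrite !subv_add; apply/and3P; split.
  - by rewrite [X in (_ <= X)%VS]expvSl prodvSl.
  - by rewrite -E3 prodvSr // -memvE power_mem_expv.
  - by rewrite -prodvA -!expvSl (expv_nil_sub G).
have NX k : (N ^+ (n - k).+1 <= <<X>>)%VS.
  elim: k => [|k IH]; first by rewrite subn0 expvSl (expv_nil_eq0 G) prodv0 sub0v.
  have [lt|le] := ltnP k n; last by rewrite (_ : n - k.+1 = n - k)%N //; lia.
  have Ek : (n - k = (n - k.+1).+1)%N by lia.
  apply: subv_trans (step _) _; rewrite subv_add -memvE xX /=.
  by rewrite -Ek.
case: G => _ [_ ->] _ _ _; rewrite subv_add -memvE -[1](expr0 x) xX /=.
by have := NX n; rewrite subnn expv1.
Qed.

Lemma powers_basis : basis_of V X.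
Proof.
by rewrite basisEdim powers_span size_tuple leqnn.
Qed.

Definition poly_rep (v : R) : {poly K} := \sum_(i < n) coord X i v *: 'X^i.

Lemma poly_rep_linear : linear poly_rep.
Proof.
move=> a u v; rewrite /poly_rep scaler_sumr -big_split; apply: eq_bigr => i _ /=.
by rewrite linearP /= scalerDl scalerA.
Qed.

Lemma size_poly_rep v : (size (poly_rep v) <= n)%N.
Proof.
apply: leq_trans (size_sum _ _ _) _; apply/bigmax_leqP => i _.
by apply: leq_trans (size_scale_leq _ _) _; rewrite size_polyXn.
Qed.

Lemma coef_poly_rep v (i : 'I_n) : (poly_rep v)`_i = coord X i v.
Proof.
rewrite coef_sum (bigD1 i) //= big1 => [|j ji].
  by rewrite coefZ coefXn eqxx mulr1 addr0.
by move: ji; rewrite -val_eqE /= coefZ coefXn eq_sym => /negPf ->; rewrite mulr0.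
Qed.

Lemma poly_repK v : v \in V -> horner_alg x (poly_rep v) = v.
Proof.
move=> vV; rewrite [RHS](coord_basis powers_basis vV) linear_sum; apply: eq_bigr => i _.
by rewrite linearZ /= rmorphXn /= horner_algX nth_powers mulr_algl.
Qed.

Lemma mul_power v k : v \in V ->
  v * x ^+ k = \sum_(i < n) (poly_rep v)`_i *: x ^+ (i + k).
Proof.
move=> vV; rewrite {1}(coord_basis powers_basis vV) mulr_suml; apply: eq_bigr => i _.
by rewrite coef_poly_rep nth_powers -scalerAl -exprD.
Qed.

(** The top power spans the socle of [V], where the form [psi] cannot vanish. *)
Lemma top_power_neq0 : psi (x ^+ n.-1) != 0.
Proof.
have n0 : (0 < n)%N by rewrite /n (dim_local G).
have ltn1 : (n.-1 < n)%N by rewrite prednK.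
have xV : x ^+ n.-1 \in V.
  by apply: (basis_mem powers_basis); apply/mapP; exists (Ordinal ltn1); rewrite ?mem_enum.
apply/eqP => H; suff x0 : x ^+ n.-1 = 0.
  have /freeP := basis_free powers_basis => /(_ (fun i => (i == Ordinal ltn1)%:R)).
  rewrite (bigD1 (Ordinal ltn1)) //= big1 => [|i /negPf ->]; last by rewrite scale0r.
  rewrite eqxx (nth_powers (Ordinal ltn1)).
  rewrite x0 scaler0 addr0 => /(_ erefl (Ordinal ltn1)); rewrite eqxx => /eqP.
  by rewrite oner_eq0.
case: (G) => cV _ _ _ nd; apply: nd => // w wV.
rewrite cV // (mul_power n.-1 wV) linear_sum big1 // => i _; rewrite linearZ /=.
have [i0|i0] := posnP i; first by rewrite i0 add0n H scaler0.
by rewrite power_eq0 ?linear0 ?scaler0 //; lia.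
Qed.

(** The [n - 1] orthogonality conditions have a nonzero solution [v].  If its
    constant coefficient is 0, multiplying [v] by powers of [x] and using
    [psi (x^(n-1)) != 0] kills the other coefficients one after the other. *)
Lemma orthogonal_unit : exists g : {poly K}, [/\ g.[0] != 0, (size g <= n)%N &
  forall k, (k < n.-1)%N -> psi (horner_alg x g * x ^+ k) = 0].
Proof.
have n0 : (0 < n)%N by rewrite /n (dim_local G).
pose C := <<[seq (x ^+ i)%R | i <- iota 0 n.-1]>>%VS.
have dC : (\dim C < n)%N.
  apply: leq_ltn_trans (dim_span _) _; rewrite size_map size_iota; lia.
have : (0 < \dim (orthv psi V C))%N.
  by rewrite -(ltn_add2r (\dim C)) add0n (leq_trans dC (dim_orthv psi V C)).
rewrite lt0n dimv_eq0 -vpick0; set v := vpick _ => v0.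
have /mem_orthv[vV Hv] : v \in orthv psi V C by apply: memv_pick.
have Hk k : (k < n.-1)%N -> psi (v * x ^+ k) = 0.
  by move=> lt; apply/Hv/memv_span/map_f; rewrite mem_iota.
exists (poly_rep v); split; rewrite ?poly_repK ?size_poly_rep //.
rewrite horner_coef0; apply: contraNneq v0 => c0.
have Hi i : (poly_rep v)`_i = 0.
  elim/ltn_ind: i => i IH; have [lt|le] := ltnP i n; last first.
    by rewrite nth_default // (leq_trans (size_poly_rep v)).
  have [-> //|i0] := posnP i.
  have /Hk : (n.-1 - i < n.-1)%N by lia.
  rewrite (mul_power _ vV) linear_sum (bigD1 (Ordinal lt)) //= big1 ?addr0 => [|j ji].
    rewrite linearZ /= subnKC; last by lia.
    by move/eqP; rewrite mulf_eq0 (negPf top_power_neq0) orbF => /eqP.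
  have [ltj|lej] := ltnP j i; first by rewrite IH // scale0r linear0.
  rewrite power_eq0 ?scaler0 ?linear0 //; move: ji; rewrite -val_eqE /=; lia.
rewrite -(poly_repK vV) (_ : poly_rep v = 0) ?linear0 //.
by apply/polyP => i; rewrite Hi coef0.
Qed.

(** The points [t] of the affine line give the linear forms [v |-> v(t)], where
    [v] is written as a polynomial in [x]; this is the rational normal curve of
    degree [n - 1].  Products of [d] elements are polynomials of degree at most
    [(n - 1) d], on which [psi] admits a quadrature with node polynomial
    [g + c X^q]: the part [c X^q] is invisible to [psi] as [x^q = 0], and it
    makes the roots simple. *)
Lemma curvilinear_waring : waring_le V psi ((n.-1 * d.-1).+1).
Proof.
have n0 : (0 < n)%N by rewrite /n (dim_local G).
have [g [g0 sg Hg]] := orthogonal_unit.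
set q := (n.-1 * d.-1).+1.
have le_nq : (n <= q)%N by rewrite /q; nia.
have [c c0 simple] := perturb_simple_roots charK0 g0 (leq_trans sg le_nq).
have Llin : linear (fun p : {poly K} => psi (horner_alg x p)).
  move=> a p r; rewrite rmorphD /= -mul_polyC rmorphM /= horner_algC mulr_algl.
  exact: linearP.
pose L : {linear {poly K} -> K^o} := mk_linear Llin.
have [| | |cz [scz Hcz]] := @quadrature_closed K L (g + c *: 'X^q) (n.-1 * d) q.
- by rewrite addrC size_polyDl size_scale // size_polyXn // ltnS (leq_trans sg).
- exact: simple.
- move=> k hk.
  rewrite /L /= rmorphM rmorphD /= linearZ /= !rmorphXn /= horner_algX
     mulrDl linearD /= Hg; last by lia.
  by rewrite power_eq0 // mulr0 mul0r linear0 addr0.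
have ulin t : linear (fun v => (poly_rep v).[t] : K^o).
  by move=> a v w; rewrite poly_rep_linear hornerD hornerZ.
pose u t : 'Hom(R, K^o) := linfun (mk_linear (ulin t)).
exists [seq (a.1, u a.2) | a <- cz]; rewrite size_map; split=> // s ss sV.
have -> : \prod_(y <- s) y = horner_alg x (\prod_(y <- s) poly_rep y).
  rewrite rmorph_prod /= big_seq [RHS]big_seq; apply: eq_bigr => y ys.
  by rewrite poly_repK ?sV.
rewrite [LHS]Hcz ?big_map; last first.
  rewrite mulnC -ss mulnC; apply: size_prod_le => y _.
  by rewrite prednK // size_poly_rep.
apply: eq_bigr => a _; rewrite horner_prod; congr (_ * _).
apply: eq_bigr => y _ /=; rewrite lfunE //.
Qed.

End Curvilinear.

Section Split.
Variables (V N : {vspace R}) (psi : 'Hom(R, K^o)) (y : R).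
Hypothesis G : local_gorenstein V N psi.
Hypothesis yN : y \in N.
Hypothesis yNN : forall a, a \in (N * N)%VS -> y * a = 0.
Hypothesis psiy : psi y = 0.
Hypothesis psiyy : psi (y * y) != 0.

Let e := y * y.
Let M := orthv psi N <[y]>.
Let V' := (<[1]> + M)%VS.

Let cV : {in V &, commutative *%R}. Proof. by case: G. Qed.
Let NV a : a \in N -> a \in V. Proof. by case: G => _ [/subvP H _] *; apply: H. Qed.
Let MN a : a \in M -> a \in N. Proof. by case/mem_orthv. Qed.

Let Vdec v : v \in V -> exists c a, a \in N /\ v = c%:A + a.
Proof. exact: (local_decomp G). Qed.

Lemma square_mul_nil a : a \in N -> a * e = 0 /\ e * a = 0.
Proof.
move=> aN; have E : e * a = 0 by rewrite -mulrA yNN // memv_mul.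
split=> //; rewrite cV ?NV //; by case: G => _ _ /subvP NN _ _; apply/NN/memv_mul.
Qed.

(** [a y] is in the socle, the products with [N] being in [y N^2]; and [psi] kills it. *)
Lemma complement_mul_eq0 a : a \in M -> a * y = 0 /\ y * a = 0.
Proof.
case/mem_orthv => aN /(_ y (memv_line y)) H.
suff E : a * y = 0 by split=> //; rewrite -cV ?NV.
have ayN : a * y \in N by case: G => _ _ /subvP NN _ _; apply/NN/memv_mul.
case: G => _ _ _ _; apply; first exact: NV.
move=> w /Vdec[c [b [bN ->]]]; rewrite mulrDr linearD /= -scalerAr mulr1 linearZ /= H.
rewrite -mulrA [y * b]cV ?NV // mulrA [a * b * y]cV ?NV //; last first.
  by case: G => _ _ /subvP NN _ _; apply/NN/memv_mul.
by rewrite yNN ?memv_mul // !linear0 addr0.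
Qed.

Lemma complement_mul v : v \in V' -> exists c, [/\ v * y = c *: y, y * v = c *: y & v * e = c *: e].
Proof.
case/memv_addP => u /vlineP[c ->] [a aM ->]; exists c.
have [ay ya] := complement_mul_eq0 aM; have [ae _] := square_mul_nil (MN aM).
split; first by rewrite mulrDl -scalerAl mul1r ay addr0.
  by rewrite mulrDr -scalerAr mulr1 ya addr0.
by rewrite mulrDl -scalerAl mul1r ae addr0.
Qed.

Lemma complement_sub : (V' <= V)%VS.
Proof.
rewrite subv_add -memvE (local_one_mem G) /=; apply/subvP => a /MN; exact: NV.
Qed.

Lemma dim_complement_lt : (\dim V' < \dim V)%N.
Proof.
have [E|ne] := eqVneq V' V; last by
   rewrite ltn_neqAle dimvS ?complement_sub // andbT dimv_leqif_eq ?complement_sub.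
have : y \in V' by rewrite E NV.
case/complement_mul => c [Hc _ _]; move: psiyy; rewrite Hc linearZ /= psiy scaler0.
by rewrite eqxx.
Qed.

Let eta v : K := psi (v * y) / psi e.
Let pp v : K := psi (v * e) / psi e.
Let proj v := v - eta v *: y.

Lemma projection_mem v : v \in V -> proj v \in V'.
Proof.
case/Vdec=> c [a [aN ->]].
have -> : proj (c%:A + a) = c%:A + (a - (psi (a * y) / psi e) *: y).
  have -> : psi (a * y) = psi ((c%:A + a) * y).
    by rewrite mulrDl -scalerAl mul1r linearP /= psiy scaler0 add0r.
  by rewrite addrA.
rewrite memv_add ?memvZ ?memv_line //; apply/mem_orthv; split.
  by rewrite rpredB ?rpredZ.
move=> _ /vlineP[k ->]; rewrite -scalerAr linearZ /= mulrBl linearB /= -scalerAl linearZ /=.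
by rewrite [X in _ - X](_ : _ = psi (a * y)) ?subrr ?scaler0 // /GRing.scale /= divfK.
Qed.

Lemma projection_mul v : v \in V -> proj v * e = pp v *: e /\ proj v * y = pp v *: y.
Proof.
move=> vV; have [c [H1 _ H2]] := complement_mul (projection_mem vV).
suff -> : pp v = c by [].
have : v * e = c *: e.
  rewrite -H2 mulrBl -scalerAl; have [-> _] := square_mul_nil yN.
  by rewrite scaler0 subr0.
by rewrite /pp => ->; rewrite linearZ /= /GRing.scale /= mulfK.
Qed.

(** [V] is the orthogonal sum of [V'] and of the line of [y]. *)
Lemma complement_gorenstein : local_gorenstein V' M psi.
Proof.
have MM : (M * M <= M)%VS.
  apply/prodvP => a b aM bM; apply/mem_orthv; split.
    by case: G => _ _ /subvP NN _ _; apply/NN/memv_mul; apply: MN.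
  move=> _ /vlineP[k ->]; rewrite -scalerAr -mulrA; have [-> _] := complement_mul_eq0 bM.
  by rewrite mulr0 scaler0 linear0.
split=> //.
- by move=> a b /(subvP complement_sub) aV /(subvP complement_sub); apply: cV.
- by split=> //; rewrite addvSr.
- case: G => _ _ _ [k Nk] _; exists k; apply/eqP; rewrite -subv0 -Nk expvS //.
  exact/subvP/MN.
- move=> v vV' Hv; case: G => _ _ _ _; apply; first exact: (subvP complement_sub).
  move=> w wV; rewrite -[w](subrK (eta w *: y)) mulrDr linearD /= Hv ?projection_mem //.
  have [c [vy _ _]] := complement_mul vV'.
  by rewrite -scalerAr vy !linearZ /= psiy !scaler0 addr0.
Qed.

(** As [y] kills the maximal ideal of [V'], the terms of the product that involve
    [y] only see the residues [pp v] of the other factors; [h] collects them as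
    a polynomial in [y], where [y^3 = 0]. *)
Lemma prod_projection (s : seq R) : {subset s <= V} ->
  let h := (\prod_(v <- s) ((pp v)%:P + (eta v) *: 'X)) in
  y * (\prod_(v <- s) proj v) = h`_0 *: y /\
  \prod_(v <- s) v = \prod_(v <- s) proj v + h`_1 *: y + h`_2 *: e.
Proof.
elim: s => [|v s IH] sV h.
  by rewrite /h !big_nil !coefC /= mulr1 scale1r !scale0r !addr0.
have [|IH1 IH2] := IH; first by move=> z zs; apply: sV; rewrite inE zs orbT.
have vV : v \in V by apply: sV; rewrite mem_head.
have [pe py] := projection_mul vV.
have [ye ey] := square_mul_nil yN.
have yp : y * proj v = pp v *: y.
  by rewrite cV // ?(NV yN) //; apply: (subvP complement_sub); apply: projection_mem.
move: IH1 IH2;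
 set g := \prod_(v <- s) ((pp v)%:P + eta v *: 'X); set P := \prod_(v <- s) proj v => IH1 IH2.
have -> : h = (pp v)%:P * g + eta v *: ('X * g) by rewrite /h big_cons mulrDl -scalerAl.
rewrite !coefD !coefCM !coefZ !coefXM /= mulr0 addr0 !big_cons -/P; split.
  by rewrite mulrA yp -scalerAl IH1 scalerA.
rewrite IH2 -{1}[v](subrK (eta v *: y)) -/(proj v) mulrDl !mulrDr.
rewrite -!scalerAr -!scalerAl IH1 pe py ye -/e !scaler0 !addr0 !scalerA !scalerDl.
rewrite [pp v * _]mulrC [pp v * g`_2]mulrC.
by rewrite [g`_1 * eta v]mulrC addrACA -!addrA; congr (_ + _); rewrite addrCA !addrA.
Qed.

(** By [prod_projection] the form on [V] is the sum of the form on [V'] and of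
    [psi (y^2)] times a coefficient of degree 2, a binary form. *)
Lemma waring_split r : waring_le V' psi r -> waring_le V psi (r + d.-1).
Proof.
case=> cu [scu Hcu]; have [cz [scz Hcz]] := quadrature_coef2 charK0 hd.
have etalin : linear (eta : R -> K^o).
  by move=> a u v; rewrite /eta mulrDl -scalerAl linearP /GRing.scale /= mulrDl -mulrA.
have pplin : linear (pp : R -> K^o).
  by move=> a u v; rewrite /pp mulrDl -scalerAl linearP /GRing.scale /= mulrDl -mulrA.
have prlin : linear proj.
  by move=> a u v; rewrite /proj etalin
       [(_ + _) *: y]scalerDl opprD scalerBr (scalerA a (eta u) y) addrACA.
pose F := linfun (mk_linear prlin).
have FE v : F v = proj v by rewrite lfunE.
pose u t : 'Hom(R, K^o) := linfun (mk_linear pplin) + t *: linfun (mk_linear etalin).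
have uE t v : u t v = pp v + t * eta v by rewrite add_lfunE scale_lfunE !lfunE.
exists ([seq (a.1, (a.2 \o F)%VF) | a <- cu] ++ [seq (psi e * a.1, u a.2) | a <- cz]).
rewrite size_cat !size_map leq_add //; split=> // s ss sV.
have [_ ->] := prod_projection sV.
rewrite !linearD /= !linearZ /= psiy scaler0 addr0 big_cat !big_map /=; congr (_ + _).
  have := Hcu [seq proj v | v <- s]; rewrite size_map big_map => ->//.
    apply: eq_bigr => a _; rewrite big_map; congr (_ * _); apply: eq_bigr => v _.
    by rewrite comp_lfunE FE.
  by move=> _ /mapP[v vs ->]; apply/projection_mem/sV.
rewrite Hcz; last first.
  rewrite -ss -[size s]mul1n; apply: size_prod_le => v _.
  apply: leq_trans (size_polyD _ _) _; rewrite geq_max size_polyC.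
  by rewrite (leq_trans (leq_b1 _)) //= (leq_trans (size_scale_leq _ _)) ?size_polyX.
rewrite /GRing.scale /= mulr_suml; apply: eq_bigr => a _.
rewrite [psi e * _]mulrC -!mulrA; congr (_ * _); rewrite mulrC; congr (_ * _).
rewrite horner_prod; apply: eq_bigr => v _.
by rewrite uE hornerD hornerC hornerZ hornerX [eta v * _]mulrC.
Qed.

End Split.
End Waring.

(** * Existence of a splitting in length at most five *)

Section Dichotomy.
Variables (K : closedFieldType) (charK0 : [pchar K] =i pred0) (R : falgType K).
Variables (V N : {vspace R}) (psi : 'Hom(R, K^o)).
Hypothesis G : local_gorenstein V N psi.
Hypothesis dV : (\dim V <= 5)%N.

Let cV : {in V &, commutative *%R}. Proof. by case: G. Qed.
Let NV a : a \in N -> a \in V. Proof. by case: G => _ [/subvP H _] *; apply: H. Qed.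
Let NN a b : a \in N -> b \in N -> a * b \in N.
Proof. by case: G => _ _ /subvP NN _ _ *; apply/NN/memv_mul. Qed.
Let NNN : (N * N <= N)%VS. Proof. by case: G. Qed.

Let Vdec v : v \in V -> exists c a, a \in N /\ v = c%:A + a.
Proof. exact: (local_decomp G). Qed.

Let V_mul a b : a \in V -> b \in V -> a * b \in V.
Proof.
move=> /Vdec[c [a' [a'N ->]]] /Vdec[c' [b' [b'N ->]]].
rewrite mulrDl !mulrDr -!scalerAl !mul1r -scalerAr mulr1.
by rewrite !(rpredD, rpredZ) ?(local_one_mem G) // NV ?NN.
Qed.

Let NN_ideal z w : z \in (N * N)%VS -> w \in V -> z * w \in (N * N)%VS.
Proof.
move=> zNN /Vdec[c [a [aN ->]]]; rewrite mulrDr rpredD //.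
  by rewrite -scalerAr mulr1 rpredZ.
by rewrite memv_mul // (subvP NNN).
Qed.

(** Let [Q] be the annihilator of [N^2].  If [N] is not principal modulo [N^2],
    then [\dim Q >= 3]; as [2 * 3 > 5 >= \dim V], the subspace [Q] is not
    isotropic, and polarization gives [y] in [Q] with [psi (y^2) != 0].
    Subtracting from [y] a multiple of the socle element [y^2] achieves
    [psi y = 0] without changing [y^2] or [y N^2]. *)
Lemma principal_or_split :
  (exists2 x, x \in N & (N <= <[x]> + N * N)%VS) \/
  exists y, [/\ y \in N, forall a, a \in (N * N)%VS -> y * a = 0, psi y = 0 & psi (y * y) != 0].
Proof.
have [small|big] := leqP (\dim N) (\dim (N * N)).+1.
  left; have [E|ne] := eqVneq (N * N)%VS N.
    by exists 0; rewrite ?mem0v // E addvSr.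
  have [x xN xNN] : exists2 x, x \in N & x \notin (N * N)%VS.
    have /subvPn[x xN xNN] : ~~ (N <= N * N)%VS; last by exists x.
    by apply: contra ne => H; rewrite eqEsubv NNN.
  exists x => //; suff E : (<[x]> + N * N)%VS = N by rewrite E.
  by apply/eqP; rewrite eqEdim subv_add -memvE xN NNN addvC dim_addv_line.
right; pose Q := orthv psi V (N * N).
have [_ _ _ [kN Nk] nd] := G.
(* If [N^2 = 0], then [N] is the socle, of dimension at least 2, and [psi] vanishes
   on some nonzero element of it. *)
have NN0 : (N * N != 0)%VS.
  apply/eqP => NN0; have : (0 < \dim (orthv psi N <[1]>))%N.
    rewrite -(ltn_add2r (\dim <[1 : R]>)) add0n; apply: leq_trans (dim_orthv _ _ _).
    by move: big; rewrite NN0 dimv0 dim_vline oner_neq0.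
  rewrite lt0n dimv_eq0 -vpick0; set z := vpick _ => /eqP; apply.
  have /mem_orthv[zN Hz] : z \in orthv psi N <[1]> by apply: memv_pick.
  apply: nd; first exact: NV.
  move=> w /Vdec[c [a [aN ->]]]; rewrite mulrDr linearD /= -scalerAr linearZ /=.
  rewrite Hz ?memv_line // (_ : z * a = 0) ?linear0 ?scaler0 ?addr0 //.
  by apply/eqP; rewrite -memv0 -NN0 memv_mul.
(* A unit does not annihilate [N^2]. *)
have QN q : q \in Q -> q \in N.
  case/mem_orthv => /Vdec[c [a [aN ->]]] Hq.
  have [->|c0] := eqVneq c 0; first by rewrite scale0r add0r.
  have Hz z : z \in (N * N)%VS -> (c%:A + a) * z = 0.
    move=> zNN; apply: nd.
      by apply: V_mul; [rewrite rpredD ?rpredZ ?(local_one_mem G) // NV | rewrite NV // (subvP NNN)].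
    by move=> w wV; rewrite -mulrA Hq ?NN_ideal.
  have N23 : (N * N <= N * (N * N))%VS.
    apply/subvP => z zNN; have /eqP := Hz z zNN.
    rewrite mulrDl -scalerAl mul1r addr_eq0 => /eqP H.
    by rewrite -[z](scalerK c0) H rpredZ // rpredN memv_mul.
  case/negP: NN0; rewrite -subv0 -Nk.
  have Nj j : (N * N <= N ^+ j.+2)%VS.
    elim: j => [|j IH]; first by rewrite expv2.
    by rewrite expvSl; apply: subv_trans N23 (prodvS _ IH).
  exact: subv_trans (Nj kN) (expv_nil_sub G _).
have [q1 [q2 [q1Q q2Q q12]]] : exists q1 q2, [/\ q1 \in Q, q2 \in Q & psi (q1 * q2) != 0].
  have QV : (Q <= V)%VS by apply/subvP => q /QN; apply: NV.
  have : ~~ (Q <= orthv psi V Q)%VS.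
    apply/negP => /dimvS HQ; have := dim_orthv_nondeg cV QV nd.
    have := dim_orthv psi V (N * N); rewrite -/Q.
    have := dim_local G; move: big HQ dV.
    move: (\dim Q) (\dim (orthv psi V Q)) (\dim V) (\dim N) (\dim (N * N)%VS) => a b c e f.
    by lia.
  case/subvPn => q1 q1Q /mem_orthv H.
  have : ~~ (Q <= lker (psi \o amull q1))%VS.
    apply/negP => /subvP Hq; apply: H; split=> [|u /Hq]; first exact: (subvP QV).
    by rewrite memv_ker comp_lfunE lfunE => /eqP.
  case/subvPn => q2 q2Q; rewrite memv_ker comp_lfunE lfunE => ?.
  by exists q1, q2.
have [y0 y0Q y0y] : exists2 y, y \in Q & psi (y * y) != 0.
  have [E1|] := eqVneq (psi (q1 * q1)) 0; last by exists q1.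
  have [E2|] := eqVneq (psi (q2 * q2)) 0; last by exists q2.
  exists (q1 + q2); first by rewrite rpredD.
  rewrite mulrDl !mulrDr !linearD /= E1 E2 add0r addr0 [q2 * q1]cV ?NV ?QN //.
  by rewrite -mulr2n -mulr_natr mulf_neq0 // natr_neq0.
have y0N := QN _ y0Q.
have y0NN z : z \in (N * N)%VS -> y0 * z = 0.
  move=> zNN; apply: nd; first by apply: V_mul; rewrite NV // (subvP NNN).
  by move=> w wV; rewrite -mulrA; case/mem_orthv: y0Q => _ ->; rewrite ?NN_ideal.
pose e := y0 * y0; pose l := psi y0 / psi e.
have eN a : a \in N -> e * a = 0 by move=> aN; rewrite -mulrA y0NN // memv_mul.
have eN' : e \in N by apply: NN.
have yey0 : y0 * e = 0 by rewrite y0NN // memv_mul.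
exists (y0 - l *: e); split.
- by rewrite rpredB ?rpredZ.
- move=> a aNN; rewrite mulrBl y0NN // -scalerAl eN ?scaler0 ?subr0 //.
  exact: (subvP NNN).
- by rewrite linearB linearZ /= /l /GRing.scale /= divfK ?subrr.
- rewrite mulrBl !mulrBr -scalerAr yey0 scaler0 subr0 -scalerAl eN // scaler0 sub0r.
  by rewrite -scalerAl -scalerAr eN // !scaler0 oppr0 subr0.
Qed.
End Dichotomy.

Lemma gorenstein_waring (K : closedFieldType) (charK0 : [pchar K] =i pred0)
  (d : nat) (hd : (4 <= d)%N) (R : falgType K) (V N : {vspace R}) (psi : 'Hom(R, K^o)) :
  local_gorenstein V N psi -> (\dim V <= 5)%N ->
  waring_le d V psi ((\dim V).-1 * d.-1).+1.
Proof.
have [n] := ubnP (\dim V); elim: n => // n IH in V N *; rewrite ltnS => le_n G dV.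
case: (principal_or_split charK0 G dV) => [[x xN Nx]|[y [yN yNN py pyy]]].
  exact: curvilinear_waring G Nx xN.
have lt := dim_complement_lt G yN yNN py pyy.
have [||cu [scu Hcu]] := waring_split charK0 hd G yN yNN py pyy
   (IH _ _ _ (complement_gorenstein G yN yNN py pyy) _).
- by apply: leq_trans lt _.
- by apply: leq_trans (ltnW lt) _.
exists cu; split=> //; apply: leq_trans scu _; rewrite addSn ltnS.
rewrite -mulSnr leq_mul2r; apply/orP; right.
have := dim_local (complement_gorenstein G yN yNN py pyy); move: lt.
by move: (\dim _) (\dim V) (\dim _) => a b c; lia.
Qed.

(** * Coordinates on graded quotients *)

Section LinAlg.
Variables (K : fieldType) (vT : vectType K).

Definition lin_closed (V : lmodType K) (Q : V -> Prop) :=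
  Q 0 /\ forall a u v, Q u -> Q v -> Q (a *: u + v).

Lemma vspace_of_pred (Q : vT -> Prop) : lin_closed Q ->
  exists U : {vspace vT}, forall v, v \in U <-> Q v.
Proof.
case=> Q0 QD.
suff H n (U : {vspace vT}) : (forall v, v \in U -> Q v) -> (\dim {:vT} <= \dim U + n)%N ->
    exists U : {vspace vT}, forall v, v \in U <-> Q v.
  apply: (H (\dim {:vT}) 0%VS) => [v|]; last by rewrite leq_addl.
  by rewrite memv0 => /eqP->.
elim: n U => [|n IH] U UQ dU.
  exists U => v; split=> [/UQ //|_]; have : (U == fullv)%VS by rewrite eqEdim subvf -[\dim U]addn0.
  by move/eqP->; rewrite memvf.
case: (classic (forall v, Q v -> v \in U)) => [H|].
  by exists U => v; split; [apply: UQ|apply: H].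
move/not_all_ex_not => [v H]; have [Qv /negP vU] := imply_to_and _ _ H.
apply: (IH (U + <[v]>)%VS) => [_ /memv_addP[u uU [_ /vlineP[a ->] ->]]|].
  by rewrite addrC; apply: QD => //; apply: UQ.
by rewrite dim_addv_line // addSnnS.
Qed.

(** The coordinates of the projection to a complement of [U]. *)
Lemma coordinates_mod (U : {vspace vT}) k : (\dim U + k = \dim {:vT})%N ->
  exists c : {linear vT -> 'rV[K]_k},
    (forall v, c v = 0 <-> v \in U) /\ forall u, exists v, c v = u.
Proof.
have UC : (U^C :&: U = 0)%VS by rewrite capvC capv_compl.
have CU : (U :&: U^C = 0)%VS by rewrite capv_compl.
have UCf w : (w \in U^C + U)%VS by rewrite addvC addv_complf memvf.
have := dimv_compl U => dC HU; have {HU} : k = \dim U^C by move: dC HU (dimvS (subvf U)); lia.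
move=> -> {k}; pose X := vbasis (U^C)%VS; pose pr := daddv_pi (U^C)%VS U.
have lc : linear (fun v => \row_i coord X i (pr v)).
  by move=> a u v; apply/rowP => i; rewrite !mxE !linearP.
exists (mk_linear lc); split=> [v|u] /=.
  split=> [/rowP H|vU].
    rewrite -(daddv_pi_add UC (UCf v)) [X in X + _](_ : _ = 0) ?add0r ?memv_pi //.
    rewrite (coord_vbasis (memv_pi (U^C)%VS U v)) big1 // => i _.
    by have := H i; rewrite !mxE => ->; rewrite scale0r.
  have prv : pr v = 0.
    have := daddv_pi_add UC (UCf v); rewrite -/pr (daddv_pi_id CU vU) => /eqP.
    by rewrite -subr_eq0 addrK => /eqP.
  by apply/rowP => i; rewrite !mxE prv linear0.
exists (\sum_i u 0 i *: X`_i); apply/rowP => i; rewrite mxE /pr daddv_pi_id //.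
  by rewrite coord_sum_free ?(basis_free (vbasisP _)).
by apply: rpred_sum => j _; rewrite rpredZ // vbasis_mem // mem_nth // size_tuple.
Qed.

End LinAlg.

Lemma lin_closed_sum (K : fieldType) (V : lmodType K) (Q : V -> Prop) (I : Type) (s : seq I)
  (P : pred I) (a : I -> K) (v : I -> V) : lin_closed Q -> (forall i, P i -> Q (v i)) ->
  Q (\sum_(i <- s | P i) a i *: v i).
Proof.
move=> [Q0 QD] Qv; elim: s => [|i s IH]; first by rewrite big_nil.
by rewrite big_cons; case: ifP => // Pi; apply: QD => //; apply: Qv.
Qed.

Lemma lin_closed_opp (K : fieldType) (V : lmodType K) (Q : V -> Prop) u :
  lin_closed Q -> Q u -> Q (- u).
Proof. by move=> [Q0 QD] Qu; rewrite -[- u]addr0 -scaleN1r; apply: QD. Qed.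

Lemma fin_choice (n : nat) (T : Type) (P : 'I_n -> T -> Prop) :
  (forall i, exists x, P i x) -> exists f, forall i, P i (f i).
Proof.
elim: n P => [|n IH] P H; first by exists (fun i : 'I_0 => False_rect T (notF (valP i))); case.
have [f Hf] := IH (fun i => P (lift ord0 i)) (fun i => H _).
have [x Hx] := H ord0.
exists (fun i => if unlift ord0 i is Some j then f j else x) => i.
by case: unliftP => [j ->|->].
Qed.

(** [L] is defined on the image of [F] by lifting a basis of this image, and
    extended by 0 on a complement. *)
Lemma factor_coordinates (K : fieldType) (V : lmodType K) k (c : {linear V -> 'rV[K]_k})
    (F : V -> Prop) (L : {linear V -> K^o}) : lin_closed F ->
  (forall v, F v -> c v = 0 -> L v = 0) ->
  exists mu : {linear 'rV[K]_k -> K^o}, forall v, F v -> L v = mu (c v).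
Proof.
move=> lF H; have [F0 FD] := lF.
have [|W HW] := @vspace_of_pred K _ (fun u => exists2 v, F v & c v = u).
  split; first by exists 0; rewrite ?linear0.
  move=> a _ _ [u Fu <-] [v Fv <-]; exists (a *: u + v); first exact: FD.
  by rewrite linearP.
pose X := vbasis W.
have [i|g Hg] := @fin_choice (\dim W) V (fun i v => F v /\ c v = X`_i).
  have : X`_i \in W by rewrite vbasis_mem // mem_nth // size_tuple.
  by case/HW => v Fv cv; exists v.
have lmu : linear (fun u => \sum_i coord X i u * L (g i) : K^o).
  move=> a u v; rewrite scaler_sumr -big_split; apply: eq_bigr => i _ /=.
  by rewrite linearP /= mulrDl scalerAl.
exists (mk_linear lmu) => v Fv /=.
have cW : c v \in W by apply/HW; exists v.
pose v' := \sum_i coord X i (c v) *: g i.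
have Fv' : F v' by apply: lin_closed_sum => // i _; case: (Hg i).
have : L (-1 *: v' + v) = 0.
  apply: H; first exact: FD.
  rewrite linearP linear_sum /= {2}(coord_vbasis cW) scaleN1r addrC; apply/eqP.
  rewrite subr_eq0; apply/eqP/eq_bigr => i _; case: (Hg i) => _.
  by rewrite linearZ /= => ->.
rewrite linearP /= scaleN1r addrC => /subr0_eq ->; rewrite linear_sum.
by apply: eq_bigr => i _; rewrite linearZ.
Qed.

Section Mpoly.
Variables (K : fieldType) (m : nat).
Local Notation T := {mpoly K[m.+1]}.

Definition lform (y : 'rV[K]_m.+1) : T := \sum_i y 0 i *: 'X_i.

Lemma lform_linear : linear lform.
Proof.
move=> a u v; rewrite /lform scaler_sumr -big_split; apply: eq_bigr => i _ /=.
by rewrite !mxE scalerDl scalerA.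
Qed.
HB.instance Definition _ :=
  GRing.isLinear.Build K 'rV[K]_m.+1 T _ lform lform_linear.

Lemma lform_homog y : lform y \is 1.-homog.
Proof. by apply: rpred_sum => i _; rewrite rpredZ // dhomogX /= mdeg1. Qed.

Lemma lform_eval y (v : 'rV[K]_m.+1) : (lform y).@[v 0] = \sum_i y 0 i * v 0 i.
Proof. by rewrite raddf_sum; apply: eq_bigr => i _; rewrite /= mevalZ mevalXU. Qed.

Lemma lform_delta i : lform (delta_mx 0 i) = 'X_i.
Proof.
rewrite /lform (bigD1 i) //= big1 => [|j /negPf ji]; rewrite mxE eqxx /=.
  by rewrite eqxx scale1r addr0.
by rewrite ji scale0r.
Qed.

Lemma homog1_lform (f : T) : f \is 1.-homog -> exists y, f = lform y.
Proof.
move=> /dhomogP hf; exists (\row_i f@_(U_(i))%MM); apply/mpolyP => mn.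
have [e|ne] := eqVneq (mdeg mn) 1%N.
  have /existsP[i /eqP->] : [exists i, mn == U_(i)%MM].
    by move/eqP: e; rewrite mdeg_eq1.
  rewrite raddf_sum (bigD1 i) //= big1 => [|j /negPf ji].
    by rewrite mcoeffZ mcoeffX eqxx mulr1 mxE addr0.
  rewrite mcoeffZ mcoeffX [_ == _](_ : _ = false) ?mulr0 //.
  by apply/eqP => /mnmP /(_ j); rewrite !mnm1E eqxx eq_sym ji.
rewrite (dhomog_nemf_coeff (d := 1) (mf := mdeg)) //; last exact/dhomogP.
by rewrite (dhomog_nemf_coeff (d := 1) (mf := mdeg)) ?lform_homog.
Qed.

Lemma homog_exp (a : T) k : a \is 1.-homog -> a ^+ k \is k.-homog.
Proof. by move=> /(@dhomogMn _ _ _ 1 _ k); rewrite mul1n. Qed.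

(** The map [c] identifies [T_e / I_e] with [K^k]: this is the statement that the
    Hilbert function of [I] takes the value [k] at [e], with coordinates. *)
Definition graded_coords (I : T -> Prop) e k := exists c : {linear T -> 'rV[K]_k},
  (forall f, f \is e.-homog -> (c f = 0 <-> I f)) /\
  (forall u, exists2 f, f \is e.-homog & c f = u).

Lemma homog_lin_closed e : lin_closed (fun f : T => f \is e.-homog).
Proof. by split=> [|a u v hu hv]; rewrite ?dhomog0 // rpredD // rpredZ. Qed.

Lemma graded_coords_of_vspace (I : T -> Prop) e k (U : {vspace dhomog m.+1 K e}) :
  (forall f : dhomog m.+1 K e, f \in U <-> I (mpoly_of_dhomog f)) ->
  (\dim U + k = \dim {:dhomog m.+1 K e})%N -> graded_coords I e k.
Proof.
move=> HU /coordinates_mod [c [ck cs]].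
pose pr (f : T) : dhomog m.+1 K e := DHomog (pihomogP mdeg e f).
have lc : linear (fun f => c (pr f)).
  move=> a u v; rewrite -linearP; congr (c _); apply: val_inj => /=; exact: linearP.
exists (mk_linear lc); split=> /= [f hf|u].
  by rewrite ck HU /= pihomog_dE.
have [v <-] := cs u; exists (mpoly_of_dhomog v); first exact: dhomog_is_dhomog.
congr (c _); apply: val_inj => /=; rewrite pihomog_dE //; exact: dhomog_is_dhomog.
Qed.

Lemma hilbert_graded_coords (Z : subscheme K m) e k :
  hilbert_fun Z e k -> graded_coords (sideal Z) e k.
Proof. by case=> U [HU dU]; exact: graded_coords_of_vspace HU dU. Qed.

Lemma dhomog_pred_vspace (I : T -> Prop) e : lin_closed I ->
  exists U : {vspace dhomog m.+1 K e}, forall f, f \in U <-> I (mpoly_of_dhomog f).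
Proof.
move=> [I0 ID]; apply: vspace_of_pred; split=> [|a u v Iu Iv]; first exact: I0.
by apply: ID.
Qed.

Lemma graded_coords_exists (I : T -> Prop) e : lin_closed I -> exists k, graded_coords I e k.
Proof.
move=> /(dhomog_pred_vspace e) [U HU].
exists (\dim {:dhomog m.+1 K e} - \dim U)%N; apply: graded_coords_of_vspace HU _.
by rewrite subnKC // dimvS ?subvf.
Qed.

(** An injective map between graded quotients, and its surjectivity when the
    dimensions agree.  It is used for inclusions of ideals and for
    multiplication by a nonzerodivisor. *)
Lemma graded_dim_le (I J : T -> Prop) e e' k k' (mu : {linear T -> T}) :
  graded_coords I e k -> graded_coords J e' k' ->
  (forall f, f \is e.-homog -> mu f \is e'.-homog) ->
  (forall f, f \is e.-homog -> J (mu f) -> I f) ->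
  (k <= k')%N /\ ((k' <= k)%N -> lin_closed J -> forall g, g \is e'.-homog ->
    exists2 f, f \is e.-homog & J (mu f - g)).
Proof.
move=> [c [ck cs]] [c' [ck' cs']] hmu inj.
have [i|g Hg] := @fin_choice k T (fun i f => f \is e.-homog /\ c f = delta_mx 0 i).
  by have [f hf cf] := cs (delta_mx 0 i); exists f.
pose A := \matrix_(i < k) c' (mu (g i)).
pose fu (u : 'rV[K]_k) := \sum_i u 0 i *: g i.
have hfu u : fu u \is e.-homog.
  by apply: rpred_sum => i _; rewrite rpredZ //; case: (Hg i).
have cfu u : c (fu u) = u.
  rewrite linear_sum /= [RHS]row_sum_delta; apply: eq_bigr => i _.
  by rewrite linearZ /=; case: (Hg i) => _ ->.
have Afu u : u *m A = c' (mu (fu u)).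
  rewrite mulmx_sum_row !linear_sum; apply: eq_bigr => i _.
  by rewrite rowK !linearZ.
have freeA : row_free A.
  apply/row_freeP; apply/row_freeP; rewrite -kermx_eq0; apply/eqP/row_matrixP => i.
  rewrite row0 -[row i _](cfu); apply/ck => //; apply: inj => //; apply/ck'; first exact: hmu.
  by rewrite -Afu -row_mul mulmx_ker row0.
have le_kk' : (k <= k')%N by rewrite -(eqP freeA) rank_leq_col.
split=> // le_k'k lJ h hh.
have fullA : row_full A by rewrite /row_full (eqP freeA) eqn_leq le_kk' le_k'k.
have [u Eu] := submxP (submx_full (c' h) fullA).
exists (fu u) => //; apply/ck'.
  by rewrite rpredB //; apply: hmu.
by rewrite linearB /= -Afu -Eu subrr.
Qed.

End Mpoly.

(** * Ideals and the projective Nullstellensatz *)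

Section Ideals.
Variables (K : fieldType) (m : nat).
Local Notation T := {mpoly K[m.+1]}.

Definition ideal (J : T -> Prop) :=
  [/\ J 0, forall f g, J f -> J g -> J (f + g) & forall f g, J g -> J (f * g)].

Lemma ideal_scale J a f : ideal J -> J f -> J (a *: f).
Proof. by move=> [_ _ JM] Jf; rewrite -mul_mpolyC; apply: JM. Qed.

Lemma ideal_lin J : ideal J -> lin_closed J.
Proof.
move=> iJ; have [J0 JD _] := iJ; split=> // a u v Ju Jv.
by apply: JD => //; apply: ideal_scale.
Qed.

Lemma ideal_opp J f : ideal J -> J f -> J (- f).
Proof. by move=> /ideal_lin; apply: lin_closed_opp. Qed.

Lemma ideal_sub J f g : ideal J -> J f -> J g -> J (f - g).
Proof. by move=> iJ Jf Jg; have [_ JD _] := iJ; apply: JD => //; apply: ideal_opp. Qed.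

Lemma ideal_mulr J f g : ideal J -> J f -> J (f * g).
Proof. by move=> [_ _ JM] Jf; rewrite mulrC; apply: JM. Qed.

Lemma ideal_subM J a b c d : ideal J -> J (a - b) -> J (c - d) -> J (a * c - b * d).
Proof.
move=> iJ Jab Jcd; have [_ JD JM] := iJ.
have -> : a * c - b * d = c * (a - b) + b * (c - d) by ring.
by apply: JD; apply: JM.
Qed.

Lemma sideal_ideal (Z : subscheme K m) : ideal (sideal Z).
Proof. by split; [exact: sideal0|exact: sidealD|exact: sidealM]. Qed.

Definition adjoin_gen (J : T -> Prop) g f := exists h, J (f - h * g).

Lemma adjoin_ideal J g : ideal J -> ideal (adjoin_gen J g).
Proof.
move=> iJ; have [J0 JD JM] := iJ; split.
- by exists 0; rewrite mul0r subr0.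
- move=> f f' [h Hh] [h' Hh']; exists (h + h').
  by rewrite mulrDl opprD addrACA; apply: JD.
- move=> f f' [h Hh]; exists (f * h).
  by rewrite -mulrA -mulrBr; apply: JM.
Qed.

Lemma adjoin_sub J g f : J f -> adjoin_gen J g f.
Proof. by exists 0; rewrite mul0r subr0. Qed.

Lemma adjoin_mem J g : ideal J -> adjoin_gen J g g.
Proof. by case=> J0 _ _; exists 1; rewrite mul1r subrr. Qed.

(** If each [J + (a - z l)] contains a power of [l], then so does [J], as the
    product of these ideals is in [J] up to powers of [l]. *)
Lemma null_step J (l a : T) j zs : ideal J ->
  J (l ^+ j * \prod_(z <- zs) (a - z *: l)) -> (forall k, ~ J (l ^+ k)) ->
  exists z, forall k, ~ adjoin_gen J (a - z *: l) (l ^+ k).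
Proof.
move=> iJ; elim: zs j => [|z zs IH] j Jp lJ.
  by case: (lJ j); rewrite big_nil mulr1 in Jp.
case: (classic (forall k, ~ adjoin_gen J (a - z *: l) (l ^+ k))); first by exists z.
move/not_all_ex_not => [k /NNPP [h Hh]]; apply: (IH (k + j)%N) => //.
have [_ JD JM] := iJ.
set P := \prod_(z <- zs) _; rewrite big_cons -/P in Jp.
have -> : l ^+ (k + j) * P = (l ^+ j * P) * (l ^+ k - h * (a - z *: l)) +
    h * (l ^+ j * ((a - z *: l) * P)) by rewrite exprD; ring.
by apply: JD; apply: JM.
Qed.

(** Modulo [J] every variable [X_i] is [z i *: l]. *)
Lemma ideal_eval J z (l : T) f e : ideal J -> (forall i, J ('X_i - z i *: l)) ->
  f \is e.-homog -> J (f - f.@[z] *: l ^+ e).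
Proof.
move=> iJ Jz /dhomogP hf; have [J0 JD JM] := iJ.
have Hm mn : J ('X_[mn] - 'X_[mn].@[z] *: l ^+ mdeg mn).
  rewrite mevalX mpolyXE_id mdegE expr_sum.
  have -> : (\prod_(i < m.+1) z i ^+ mn i) *: \prod_(i < m.+1) l ^+ mn i =
      \prod_(i < m.+1) (z i *: l) ^+ mn i.
    by rewrite -scaler_prod; apply: eq_bigr => i _; rewrite exprZn.
  elim/big_rec2: _ => [|i u v _]; first by rewrite subrr.
  apply: ideal_subM => //; elim: (mn i) => [|k IH]; first by rewrite !expr0 subrr.
  by rewrite !exprS; apply: ideal_subM.
rewrite [in X in X - _](mpolyE f) mevalE scaler_suml -sumrB big_seq.
apply: (big_ind J) => // mn mnf; rewrite -(hf _ mnf) -scalerA -scalerBr.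
by apply: ideal_scale => //; rewrite -mevalX.
Qed.

Lemma null_ext (J : T -> Prop) y : ideal J ->
  (forall i, exists j zs, J (lform y ^+ j * \prod_(z <- zs) ('X_i - z *: lform y))) ->
  (forall k, ~ J (lform y ^+ k)) ->
  exists J' (z : 'I_m.+1 -> K), [/\ ideal J', forall f, J f -> J' f,
    forall k, ~ J' (lform y ^+ k) & forall i, J' ('X_i - z i *: lform y)].
Proof.
move=> iJ Hi lJ; suff H (s : seq 'I_m.+1) : exists J', [/\ ideal J', forall f, J f -> J' f,
    forall k, ~ J' (lform y ^+ k) & forall i, i \in s -> exists z, J' ('X_i - z *: lform y)].
  have [J' [iJ' JJ' lJ' Hz]] := H (enum 'I_m.+1).
  have [i|z Hz'] := @fin_choice m.+1 K (fun i z => J' ('X_i - z *: lform y)).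
    by apply: Hz; rewrite mem_enum.
  by exists J', z.
elim: s => [|i s [J' [iJ' JJ' lJ' Hz]]]; first by exists J.
have [j [zs Hzs]] := Hi i.
have [z Hk] := null_step iJ' (JJ' _ Hzs) lJ'.
exists (adjoin_gen J' ('X_i - z *: lform y)); split=> //.
- exact: adjoin_ideal.
- by move=> f Jf; apply/adjoin_sub/JJ'.
- move=> i'; rewrite inE => /predU1P[->|/Hz [z' Hz']]; first by exists z; apply: adjoin_mem.
  by exists z'; apply: adjoin_sub.
Qed.

(** Adjoining one factor for each variable leaves an ideal that contains no power
    of [l = lform y] and for which all the variables are multiples of [l].  The
    ratios are the coordinates of the required zero. *)
Theorem nullstellensatz (J : T -> Prop) y : ideal J ->
  (forall i, exists j zs, J (lform y ^+ j * \prod_(z <- zs) ('X_i - z *: lform y))) ->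
  (forall k, ~ J (lform y ^+ k)) ->
  exists v : 'rV[K]_m.+1, (forall e f, f \is e.-homog -> J f -> f.@[v 0] = 0) /\
     (lform y).@[v 0] = 1.
Proof.
move=> iJ Hi /(null_ext iJ Hi) [J' [z [iJ' JJ' lJ' Hz]]].
have Hf e f : f \is e.-homog -> J' f -> f.@[z] = 0.
  move=> hf Jf; apply/eqP; apply: contraT => f0; case: (lJ' e).
  have := ideal_eval iJ' Hz hf => H; rewrite -[_ ^+ e](scalerK f0); apply: ideal_scale => //.
  by rewrite -[X in J' X](subKr f); apply: ideal_sub.
pose v := \row_i z i; have vz f : f.@[v 0] = f.@[z].
  by apply: meval_eq => i; rewrite mxE.
exists v; split=> [e f hf Jf|]; first by rewrite vz (Hf e) //; apply: JJ'.
have := ideal_eval iJ' Hz (lform_homog y); rewrite expr1 vz => H.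
apply/eqP; apply: contraT => l1; case: (lJ' 1%N); rewrite expr1.
have l10 : 1 - (lform y).@[z] != 0 by rewrite subr_eq0 eq_sym.
by rewrite -[lform y](scalerK l10); apply: ideal_scale => //; rewrite scalerBl scale1r.
Qed.

End Ideals.

Section BinaryForms.
Variables (K : closedFieldType) (m : nat).
Local Notation T := {mpoly K[m.+1]}.
Variables (a t : T).

(** The binary form of degree [e] in [a] and [t] with the coefficients of [p]. *)
Definition homogenize e (p : {poly K}) : T := \sum_(i < e.+1) p`_i *: (a ^+ i * t ^+ (e - i)).

Lemma homogenizeZ e c p : homogenize e (c *: p) = c *: homogenize e p.
Proof. by rewrite scaler_sumr; apply: eq_bigr => i _; rewrite coefZ scalerA. Qed.

Lemma homogenize_mulXsub e z (p : {poly K}) : (size p <= e.+1)%N ->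
  homogenize e.+1 (('X - z%:P) * p) = (a - z *: t) * homogenize e p.
Proof.
move=> sp; rewrite /homogenize.
under eq_bigr do rewrite mulrBl coefB coefXM coefCM scalerBl.
rewrite sumrB mulrBl; congr (_ - _).
  rewrite big_ord_recl scale0r add0r mulr_sumr; apply: eq_bigr => i _ /=.
  by rewrite /bump add1n subSS -scalerAr exprS mulrA.
rewrite big_ord_recr /= [p`_e.+1]nth_default // mulr0 scale0r addr0 mulr_sumr.
apply: eq_bigr => i _ /=; have le_ie : (i <= e)%N by rewrite -ltnS.
by rewrite -scalerAl -scalerAr scalerA (subSn le_ie) exprS mulrCA.
Qed.

Lemma homogenize_prod (zs : seq K) e : (size zs <= e)%N ->
  homogenize e (\prod_(z <- zs) ('X - z%:P)) = t ^+ (e - size zs) * \prod_(z <- zs) (a - z *: t).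
Proof.
elim: zs e => [|z zs IH] e.
  rewrite !big_nil /homogenize big_ord_recl big1 => [|i _]; last by rewrite coefC scale0r.
  by rewrite coefC scale1r mul1r addr0 mulr1.
case: e => // e; rewrite ltnS => le; rewrite !big_cons homogenize_mulXsub; last first.
  by rewrite size_prod_XsubC.
by rewrite IH // subSS mulrCA.
Qed.

(** The [e + 1] monomials [a^i t^(e-i)] are dependent modulo [I], as [T_e / I_e] has
    dimension at most [e]; the resulting binary form splits. *)
Lemma binary_relation I e k : ideal I -> graded_coords I e k -> (k <= e)%N ->
  a \is 1.-homog -> t \is 1.-homog ->
  exists j zs, I (t ^+ j * \prod_(z <- zs) (a - z *: t)).
Proof.
move=> iI [c [ck _]] le_ke ha ht.
have hat i : (i < e.+1)%N -> a ^+ i * t ^+ (e - i) \is e.-homog.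
  by move=> lti; rewrite -{2}(subnKC (lti : (i <= e)%N)) dhomogM // homog_exp.
pose A := \matrix_(i < e.+1) c (a ^+ i * t ^+ (e - i)).
have [u u0 uA] : exists2 u : 'rV_e.+1, u != 0 & u *m A = 0.
  have : kermx A != 0.
    rewrite kermx_eq0 /row_free neq_ltn; apply/orP; left.
    by rewrite ltnS (leq_trans (rank_leq_col A)).
  move/rowV0Pn => [u /sub_kermxP uA u0]; by exists u.
pose p := \poly_(i < e.+1) (if insub i is Some j then u 0 j else 0).
have pu (i : 'I_e.+1) : p`_i = u 0 i by rewrite coef_poly ltn_ord valK.
have p0 : p != 0.
  apply: contraNneq u0 => p0; apply/eqP/rowP => i; by rewrite -pu p0 coef0 mxE.
have [zs Ep] := closed_field_poly_normal p.
have lc0 : lead_coef p != 0 by rewrite lead_coef_eq0.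
have szs : (size zs <= e)%N.
  have : (size p <= e.+1)%N by apply: size_poly.
  by rewrite Ep size_scale // size_prod_XsubC.
exists (e - size zs)%N, zs; rewrite -homogenize_prod //.
rewrite -[homogenize _ _](scalerK lc0) -homogenizeZ -Ep; apply: ideal_scale => //.
apply/ck; first by apply: rpred_sum => i _; rewrite rpredZ // hat.
rewrite linear_sum -[RHS]uA mulmx_sum_row; apply: eq_bigr => i _.
by rewrite linearZ /= pu rowK.
Qed.

End BinaryForms.

(** * Supports of zero-dimensional schemes *)

Section Points.
Variables (K : fieldType) (m : nat).
Local Notation T := {mpoly K[m.+1]}.

Lemma pline_line (p : pspace K m) v : v \in pline p -> v != 0 -> pline p = <[v]>%VS.
Proof.
move=> vp v0; apply/esym/eqP; rewrite eqEdim -memvE vp dim_vline v0.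
by rewrite (eqP (pline_dim p)).
Qed.

Lemma pline_pick (p : pspace K m) : vpick (pline p) != 0.
Proof. by rewrite vpick0 -dimv_eq0 (eqP (pline_dim p)). Qed.

Lemma point_of (v : 'rV[K]_m.+1) : v != 0 -> exists p : pspace K m, pline p = <[v]>%VS.
Proof.
move=> v0; have d1 : \dim <[v]> == 1%N by rewrite dim_vline v0.
by exists (PPoint d1).
Qed.

Lemma homog_evalZ (f : T) e c (v : 'rV[K]_m.+1) : f \is e.-homog ->
  f.@[(c *: v) 0] = c ^+ e * f.@[v 0].
Proof.
move=> /dhomogP hf; rewrite !mevalE mulr_sumr [LHS]big_seq [RHS]big_seq.
apply: eq_bigr => mn mnf; rewrite mulrCA; congr (_ * _).
under eq_bigr do rewrite mxE exprMn.
by rewrite big_split /= -expr_sum -mdegE (hf _ mnf).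
Qed.

Lemma vanishes_homog (f : T) e (p : pspace K m) v : f \is e.-homog ->
  v \in pline p -> v != 0 -> vanishes_at f p <-> f.@[v 0] = 0.
Proof.
move=> hf vp v0; split=> [/(_ v vp) //|fv w]; rewrite (pline_line vp v0) => /vlineP[c ->].
by rewrite (homog_evalZ _ _ hf) fv mulr0.
Qed.

Lemma homog_decomp (f : T) : f = \sum_(e < msize f) pihomog mdeg e f.
Proof. exact: pihomog_partitionE. Qed.

Lemma supp_of_zero (Z : subscheme K m) (v : 'rV[K]_m.+1) p : v \in pline p -> v != 0 ->
  (forall e f, f \is e.-homog -> sideal Z f -> f.@[v 0] = 0) -> supp Z p.
Proof.
move=> vp v0 H f If w; rewrite (pline_line vp v0) => /vlineP[c ->].
rewrite (homog_decomp f) raddf_sum big1 //= => e _.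
rewrite (homog_evalZ _ _ (pihomogP mdeg e f)) (H e) ?mulr0 //; first exact: pihomogP.
exact: sideal_homog.
Qed.

End Points.

Section Supports.
Variables (K : closedFieldType) (m : nat) (Z : subscheme K m) (e k : nat).
Local Notation T := {mpoly K[m.+1]}.
Hypothesis HZ : graded_coords (sideal Z) e k.
Hypothesis le_ke : (k <= e)%N.
Let I := sideal Z.
Let iI : ideal I := sideal_ideal Z.

Lemma scheme_binary (a t : T) : a \is 1.-homog -> t \is 1.-homog ->
  exists j zs, I (t ^+ j * \prod_(z <- zs) (a - z *: t)).
Proof. exact: (binary_relation iI HZ le_ke). Qed.

Lemma X_homog i : ('X_i : T) \is 1.-homog.
Proof. by rewrite dhomogX /= mdeg1. Qed.

(** The binary relations of the scheme hold in every larger ideal, to which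
    [nullstellensatz] applies. *)
Lemma zero_of_scheme (J : T -> Prop) y : ideal J -> (forall f, I f -> J f) ->
  (forall k, ~ J (lform y ^+ k)) ->
  exists v p, [/\ v != 0, v \in pline p, supp Z p, (lform y).@[v 0] = 1 &
   forall e f, f \is e.-homog -> J f -> f.@[v 0] = 0].
Proof.
move=> iJ IJ lJ.
have [|v [Hv v1]] := nullstellensatz iJ _ lJ.
  move=> i; have [j [zs H]] := scheme_binary (X_homog i) (lform_homog y).
  by exists j, zs; apply: IJ.
have v0 : v != 0.
  apply/eqP => v0; move: v1; rewrite v0 lform_eval big1 => [/eqP|i _].
    by rewrite eq_sym oner_eq0.
  by rewrite mxE mulr0.
have [p Ep] := point_of v0; have vp : v \in pline p by rewrite Ep memv_line.
exists v, p; split=> //; apply: supp_of_zero vp v0 _ => e' f hf If.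
by apply: Hv hf _; apply: IJ.
Qed.

Lemma vanishing_nilpotent y : (forall p, supp Z p -> vanishes_at (lform y) p) ->
  exists k, I (lform y ^+ k).
Proof.
move=> H; apply: NNPP => /not_ex_all_not lI.
have [v [p [v0 vp sp v1 _]]] := zero_of_scheme iI (fun _ h => h) lI.
by move: v1; rewrite (H p sp v vp) => /eqP; rewrite eq_sym oner_eq0.
Qed.

(** Otherwise the ideal [J] of the [g] with [g f] in [I] contains no power of the
    irrelevant ideal, by saturation, and it has a zero in the support of the
    scheme; but it contains [lform y]. *)
Lemma nonvanishing_regular y f : (forall p, supp Z p -> ~ vanishes_at (lform y) p) ->
  I (lform y * f) -> I f.
Proof.
move=> H If; pose J g := I (g * f); have [I0 ID IM] := iI.
have iJ : ideal J.
  split=> [|g h Jg Jh|g h Jh]; rewrite /J; first by rewrite mul0r.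
    by rewrite mulrDl; apply: ID.
  by rewrite -mulrA; apply: IM.
have HX i : exists k, J ('X_i ^+ k).
  apply: NNPP => /not_ex_all_not; rewrite -lform_delta => lJ.
  have [|v [p [v0 vp sp v1 Hv]]] := zero_of_scheme iJ _ lJ.
    by move=> g Ig; apply: ideal_mulr.
  by case: (H p sp); apply/(vanishes_homog (lform_homog y) vp v0)/(Hv 1%N); rewrite ?lform_homog.
have [kk Hkk] := fin_choice HX; pose k0 := \max_i kk i.
apply: (@sideal_sat _ _ Z _ (m.+1 * k0).+1) => mn dmn; rewrite -/(J _).
have [|i le_i] := @large_summand m.+1 mn k0; first by rewrite -mdegE dmn.
rewrite mpolyXE_id (bigD1 i) //=; apply: (ideal_mulr (J := J)) => //.
have le_ki : (kk i <= mn i)%N by apply: leq_trans le_i; apply: leq_bigmax.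
by rewrite -(subnK le_ki) exprD; have [_ _ JM] := iJ; apply: JM (Hkk i).
Qed.

(** For a point [p] of the support and each linear form [a] that vanishes at [p],
    a binary relation [a^k h(a, t)] has [h(p) != 0].  Hence a form [G] that is
    the product of such [h] separates [p] from the rest of the support, which
    would be disconnected. *)
Lemma connected_point : connected Z ->
  exists v0, v0 != 0 /\ forall p, supp Z p <-> pline p = <[v0]>%VS.
Proof.
case=> [[p sp] conn]; pose w := vpick (pline p).
have w0 : w != 0 by apply: pline_pick.
have wp : w \in pline p by apply: memv_pick.
have /rV0Pn[i0 wi0] := w0; pose v := (w 0 i0)^-1 *: w.
have v0 : v != 0 by rewrite scaler_eq0 negb_or invr_eq0 wi0.
have vp : v \in pline p by rewrite memvZ.
have vi0 : v 0 i0 = 1 by rewrite mxE mulVf.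
pose t : T := 'X_i0; pose a i : T := 'X_i - v 0 i *: t.
have ht : t \is 1.-homog by apply: X_homog.
have ha i : a i \is 1.-homog by rewrite rpredB ?rpredZ ?X_homog.
have aE i (x : 'rV_m.+1) : (a i).@[x 0] = x 0 i - v 0 i * x 0 i0.
  by rewrite mevalB mevalZ !mevalXU.
have [j Hj] := fin_choice (fun i => scheme_binary (ha i) ht).
have [zs Hzs] := fin_choice Hj.
(* The factors with [z = 0] are the powers of [a i], the only ones that vanish at [p]. *)
pose Gi i := t ^+ j i * \prod_(z <- zs i | z != 0) (a i - z *: t).
pose G := \prod_i Gi i.
have hprod (s : seq T) : (forall f, f \in s -> exists e, f \is e.-homog) ->
    exists e, \prod_(f <- s) f \is e.-homog.
  elim: s => [|f s IH] Hs; first by exists 0%N; rewrite big_nil dhomog1.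
  have [|e1 h1] := Hs f; first by rewrite mem_head.
  have [|e2 h2] := IH; first by move=> g gs; apply: Hs; rewrite inE gs orbT.
  by exists (e1 + e2)%N; rewrite big_cons dhomogM.
have hGi i : exists e, Gi i \is e.-homog.
  have [|e2 h2] := hprod [seq a i - z *: t | z <- zs i & z != 0].
    by move=> _ /mapP[z _ ->]; exists 1%N; rewrite rpredB ?rpredZ.
  rewrite big_map big_filter in h2.
  by exists (j i + e2)%N; rewrite dhomogM // homog_exp.
have [e' hG] : exists e', G \is e'.-homog.
  have [|e' he] := hprod [seq Gi i | i <- enum 'I_m.+1]; first by move=> _ /mapP[i _ ->].
  by exists e'; rewrite big_map big_enum in he.
have Gv : G.@[v 0] != 0.
  rewrite rmorph_prod /=; apply/prodf_neq0 => i _;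
   rewrite mevalM rmorphXn /= mevalXU vi0 expr1n mul1r.
  rewrite rmorph_prod /= prodf_seq_neq0; apply/allP => z _; apply/implyP => z0.
  by rewrite mevalB mevalZ aE mevalXU vi0 !mulr1 subrr sub0r oppr_eq0.
have dich q x : supp Z q -> x \in pline q -> G.@[x 0] != 0 -> x = x 0 i0 *: v.
  move=> sq xq Gx; apply/rowP => i; rewrite mxE.
  move: Gx; rewrite rmorph_prod /= => /prodf_neq0 /(_ i isT).
  have := sq _ (Hzs i) x xq; rewrite (bigID (fun z => z != 0)) /= mulrA mevalM -/(Gi i).
  move/eqP; rewrite mulf_eq0 => /orP[-> //|] + _.
  rewrite rmorph_prod /= prodf_seq_eq0 => /hasP[z _ /andP[/negPn/eqP ->]].
  by rewrite scale0r subr0 aE subr_eq0 mulrC => /eqP.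
have colin q : supp Z q -> ~ vanishes_at G q -> pline q = <[v]>%VS.
  move=> sq nG; pose x := vpick (pline q).
  have xq : x \in pline q by apply: memv_pick.
  have Gx : G.@[x 0] != 0.
    by apply/eqP => Gx; apply/nG/(vanishes_homog hG xq (pline_pick q)).
  have Ex := dich q x sq xq Gx; have xi0 : x 0 i0 != 0.
    by apply: contraNneq (pline_pick q) => x0; rewrite -/x Ex x0 scale0r.
  by apply: pline_line => //; rewrite -[v](scalerK xi0) -Ex memvZ.
have cl1 : zariski_closed (fun q : pspace K m => forall i, vanishes_at (a i) q).
  exists (fun F => exists i, F = a i) => [_ [i ->]|q]; first by exists 1%N.
  by split=> [H _ [i ->] //|H i]; apply: H; exists i.
have cl2 : zariski_closed (fun q : pspace K m => vanishes_at G q).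
  by exists (fun F => F = G) => [_ ->|q]; [exists e'|split=> [H _ -> //|]; apply].
have av i : (a i).@[v 0] = 0 by rewrite aE vi0 mulr1 subrr.
have avan q : pline q = <[v]>%VS -> forall i, vanishes_at (a i) q.
  move=> Eq i; have vq : v \in pline q by rewrite Eq memv_line.
  exact/(vanishes_homog (ha i) vq v0).
exists v; split=> // q; split=> [sq|Eq]; last first.
  by move=> f If x; rewrite Eq -(pline_line vp v0); apply: sp.
have [q'|q' sq' [H1 H2]|H|H] := conn _ _ cl1 cl2.
- by move=> sq'; case: (classic (vanishes_at G q')) => [|/(colin q' sq') /avan]; [right|left].
- pose x := vpick (pline q'); have xq : x \in pline q' by apply: memv_pick.
  have Ex : x = x 0 i0 *: v.
    apply/rowP => i; rewrite mxE; have := H1 i x xq; rewrite aE => /eqP.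
    by rewrite subr_eq0 mulrC => /eqP.
  move: (H2 x xq); rewrite Ex (homog_evalZ _ _ hG) => /eqP; rewrite mulf_eq0 (negPf Gv) orbF.
  rewrite expf_eq0 => /andP[_ /eqP x0]; have := pline_pick q'.
  by rewrite -/x Ex x0 scale0r eqxx.
- apply: pline_line => //.
  pose x := vpick (pline q); have xq : x \in pline q by apply: memv_pick.
  have Ex : x = x 0 i0 *: v.
    apply/rowP => i; rewrite mxE; have := H q sq i x xq; rewrite aE => /eqP.
    by rewrite subr_eq0 mulrC => /eqP.
  have xi0 : x 0 i0 != 0.
    by apply: contraNneq (pline_pick q) => x0; rewrite -/x Ex x0 scale0r.
  by rewrite -[v](scalerK xi0) -Ex memvZ.
- by move: Gv; rewrite (H p sp v vp) eqxx.
Qed.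

End Supports.

(** * The matrix algebra of a local scheme *)

Section MulBy.
Variables (K : fieldType) (m : nat).
Local Notation T := {mpoly K[m.+1]}.
Variable a : T.
(** Multiplication, named to carry its linear structure. *)
Definition mulby (f : T) : T := a * f.
Lemma mulby_linear : linear mulby.
Proof. by move=> x u v; rewrite /mulby mulrDr scalerAr. Qed.
HB.instance Definition _ := GRing.isLinear.Build K T T _ mulby mulby_linear.
End MulBy.

Lemma mpolyX_s2m (K : fieldType) n (s : seq 'I_n) :
  'X_[s2m s] = \prod_(i <- s) 'X_i :> {mpoly K[n]}.
Proof.
elim: s => [|i s IH].
  by rewrite big_nil -mpolyX0; congr 'X_[_]; apply/mnmP => i; rewrite mnmE mnm0E.
rewrite big_cons -IH -mpolyXD; congr 'X_[_]; apply/mnmP => k.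
by rewrite !mnmE /=.
Qed.

Lemma meval_s2m (K : fieldType) n (s : seq 'I_n) (v : 'I_n -> K) :
  ('X_[s2m s] : {mpoly K[n]}).@[v] = \prod_(i <- s) v i.
Proof. by rewrite mpolyX_s2m rmorph_prod; apply: eq_bigr => i _; rewrite /= mevalXU. Qed.

Lemma sum_count_mem n (s : seq 'I_n) : (\sum_i count_mem i s = size s)%N.
Proof.
elim: s => [|k s IH]; first by rewrite big1.
rewrite /= -IH -add1n big_split /=; congr (_ + _)%N.
by rewrite (bigD1 k) //= eqxx big1 // => i /negPf; rewrite eq_sym => ->.
Qed.

Section Rep.
Variables (K : closedFieldType) (m : nat) (Z : subscheme K m).
Local Notation T := {mpoly K[m.+1]}.
Let I := sideal Z.
Let iI : ideal I := sideal_ideal Z.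
Variables (t : T) (b e0 : nat).
Hypothesis ht : t \is 1.-homog.
Hypothesis reg : forall f, I (t * f) -> I f.
Hypothesis HF : forall e, (e0 <= e)%N -> graded_coords I e b.

Lemma reg_exp s f : I (t ^+ s * f) -> I f.
Proof. by elim: s => [|s IH]; rewrite ?expr0 ?mul1r // exprS -mulrA => /reg. Qed.

(** In large degrees the multiplication by [t] is bijective on the graded
    quotients, which have the same dimension. *)
Lemma divide_t e h : (e0 <= e)%N -> h \is e.+1.-homog ->
  exists2 g, g \is e.-homog & I (t * g - h).
Proof.
move=> le hh; have [||_ H] := @graded_dim_le K m I I e e.+1 b b (mulby t) (HF le) (HF (leqW le)).
- by move=> f hf; exact: (dhomogM ht hf).
- by move=> f _ /reg.
by apply: H => //; apply: ideal_lin.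
Qed.

Lemma divide_t_exp e s h : (e0 <= e)%N -> h \is (e + s).-homog ->
  exists2 g, g \is e.-homog & I (t ^+ s * g - h).
Proof.
move=> le; elim: s h => [|s IH] h hh.
  by exists h; rewrite ?expr0 ?mul1r ?subrr; [rewrite -[e]addn0|case: iI].
rewrite addnS in hh.
have [|g hg Ig] := divide_t _ hh; first by rewrite (leq_trans le) ?leq_addr.
have [g' hg' Ig'] := IH g hg; exists g' => //.
have -> : t ^+ s.+1 * g' - h = t * (t ^+ s * g' - g) + (t * g - h) by rewrite exprS; ring.
by have [_ ID IM] := iI; apply: ID => //; apply: IM.
Qed.

Variables (j n : nat) (phi : {linear T -> K^o}) (crd : {linear T -> 'rV[K]_n.+1}).
Hypothesis le_e0j : (e0 < j)%N.
Hypothesis phiI : forall f, f \is (j + j).-homog -> I f -> phi f = 0.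
(** The radical of the bilinear form [phi (f g)] on the forms of degree [j]. *)
Definition radical_form f := forall g, g \is j.-homog -> phi (f * g) = 0.
Hypothesis crd_ker : forall f, f \is j.-homog -> (crd f = 0 <-> radical_form f).
Hypothesis crd_surj : forall u, exists2 f, f \is j.-homog & crd f = u.

(** [M] is the action of the fraction [a / t^s] on the forms of degree [j] modulo
    the radical, in the coordinates [crd]. *)
Definition rep s a (M : 'M[K]_n.+1) := forall f g,
  f \is j.-homog -> g \is j.-homog -> I (t ^+ s * g - a * f) -> crd f *m M = crd g.

Lemma crd_ideal f : f \is j.-homog -> I f -> crd f = 0.
Proof.
move=> hf If; apply/crd_ker => // g hg; apply: phiI; first exact: dhomogM.
exact: ideal_mulr.
Qed.

Lemma divide_j s h : h \is (j + s).-homog -> exists2 g, g \is j.-homog & I (t ^+ s * g - h).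
Proof. by apply: divide_t_exp; apply: ltnW. Qed.

(** The radical is stable under [a / t]: a test form [h] is replaced by [t h'],
    and [phi (g t h') = phi (f a h')]. *)
Lemma radical_div a f g : a \is 1.-homog -> f \is j.-homog -> g \is j.-homog ->
  radical_form f -> I (t * g - a * f) -> radical_form g.
Proof.
move=> ha hf hg rf Ig h hh.
have [le1 Ej1] : (e0 <= j.-1)%N /\ j = j.-1.+1 by lia.
have hh1 := hh; rewrite Ej1 in hh1; have [h' hh' Ih] := divide_t le1 hh1.
have Ej : j = (j.-1 + 1)%N by lia.
have hah : a * h' \is j.-homog by rewrite Ej addnC dhomogM.
have -> : phi (g * h) = phi (f * (a * h')).
  apply/eqP; rewrite -subr_eq0 -linearB /=; apply/eqP/phiI.
    by rewrite rpredB ?dhomogM.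
  have -> : g * h - f * (a * h') = h' * (t * g - a * f) + (- g) * (t * h' - h) by ring.
  by have [_ ID IM] := iI; apply: ID; apply: IM.
exact: rf.
Qed.

Lemma rep_exists a : a \is 1.-homog -> exists M, rep 1 a M.
Proof.
move=> ha.
have [i|fi Hfi] := @fin_choice n.+1 T (fun i f => f \is j.-homog /\ crd f = delta_mx 0 i).
  by have [f hf cf] := crd_surj (delta_mx 0 i); exists f.
have [i|gi Hgi] := @fin_choice n.+1 T (fun i g => g \is j.-homog /\ I (t * g - a * fi i)).
  have [|g hg Ig] := @divide_j 1%N (a * fi i).
    by rewrite addnC dhomogM //; case: (Hfi i).
  by exists g.
exists (\matrix_i crd (gi i)) => f g hf hg; rewrite expr1 => Ig.
pose f' := f - \sum_i crd f 0 i *: fi i; pose g' := g - \sum_i crd f 0 i *: gi i.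
have hf' : f' \is j.-homog.
  by rewrite rpredB // rpred_sum // => i _; rewrite rpredZ //; case: (Hfi i).
have hg' : g' \is j.-homog.
  by rewrite rpredB // rpred_sum // => i _; rewrite rpredZ //; case: (Hgi i).
have rf' : radical_form f'.
  apply/crd_ker => //; rewrite linearB linear_sum /=; apply/eqP; rewrite subr_eq0.
  apply/eqP; rewrite {1}[crd f]row_sum_delta; apply: eq_bigr => i _.
  by rewrite linearZ /=; case: (Hfi i) => _ ->.
have Ig' : I (t * g' - a * f').
  have -> : t * g' - a * f' = (t * g - a * f) - \sum_i crd f 0 i *: (t * gi i - a * fi i).
    have -> : \sum_i crd f 0 i *: (t * gi i - a * fi i) =
        t * (\sum_i crd f 0 i *: gi i) - a * (\sum_i crd f 0 i *: fi i).
      rewrite !mulr_sumr -sumrB; apply: eq_bigr => i _.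
      by rewrite scalerBr !scalerAr.
    by rewrite /g' /f'; ring.
  apply: ideal_sub => //; apply: lin_closed_sum; first exact: ideal_lin.
  by move=> i _; case: (Hgi i).
have /crd_ker : radical_form g' by apply: radical_div Ig'.
move=> /(_ hg')/eqP; rewrite linearB subr_eq0 => /eqP ->.
by rewrite linear_sum mulmx_sum_row; apply: eq_bigr => i _; rewrite rowK linearZ.
Qed.

Lemma rep_uniq s a M M' : a \is s.-homog -> rep s a M -> rep s a M' -> M = M'.
Proof.
move=> ha HM HM'; apply/row_matrixP => i; rewrite !rowE.
have [f hf <-] := crd_surj (delta_mx 0 i).
have [|g hg Ig] := @divide_j s (a * f); first by rewrite addnC dhomogM.
by rewrite (HM f g) // (HM' f g).
Qed.

Lemma rep_mul s s' a a' M M' : a \is s.-homog -> rep s a M -> rep s' a' M' ->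
  rep (s + s') (a * a') (M * M').
Proof.
move=> ha HM HM' f g hf hg Ig.
have [|h hh Ih] := @divide_j s (a * f); first by rewrite addnC dhomogM.
rewrite mulmxA (HM f h) // (HM' h g) //; apply: (@reg_exp s).
have -> : t ^+ s * (t ^+ s' * g - a' * h) =
   (t ^+ (s + s') * g - a * a' * f) - a' * (t ^+ s * h - a * f) by rewrite exprD; ring.
by apply: ideal_sub => //; have [_ _ IM] := iI; apply: IM.
Qed.

Lemma rep_lin s a a' M M' x : a \is s.-homog -> a' \is s.-homog ->
  rep s a M -> rep s a' M' -> rep s (x *: a + a') (x *: M + M').
Proof.
move=> ha ha' HM HM' f g hf hg Ig.
have [|h hh Ih] := @divide_j s (a * f); first by rewrite addnC dhomogM.
have [|h' hh' Ih'] := @divide_j s (a' * f); first by rewrite addnC dhomogM.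
rewrite mulmxDr -scalemxAr (HM f h) // (HM' f h') // -linearP /=.
apply/eqP; rewrite -subr_eq0 -linearB /=; apply/eqP/crd_ideal.
  by rewrite rpredB // rpredD // rpredZ.
apply: (@reg_exp s).
have -> : t ^+ s * (x *: h + h' - g) = x *: (t ^+ s * h - a * f) + (t ^+ s * h' - a' * f) -
  (t ^+ s * g - (x *: a + a') * f).
  rewrite -!mul_mpolyC; ring.
apply: ideal_sub => //; have [_ ID IM] := iI; apply: ID => //; exact: ideal_scale.
Qed.

Lemma rep0 s a : I a -> rep s a 0.
Proof.
move=> Ia f g hf hg Ig; rewrite mulmx0 crd_ideal //; apply: (@reg_exp s).
rewrite -[t ^+ s * g](subrK (a * f)); have [_ ID _] := iI; apply: ID => //.
exact: ideal_mulr.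
Qed.

Lemma rep1 s : rep s (t ^+ s) 1.
Proof.
move=> f g hf hg; rewrite -mulrBr => /reg_exp Ig; rewrite mulmx1.
apply/eqP; rewrite eq_sym -subr_eq0 -linearB; apply/eqP/crd_ideal => //.
by rewrite rpredB.
Qed.

Variable z : 'I_m.+1 -> K.
Hypothesis nil : forall i, exists k, I (('X_i - z i *: t) ^+ k).

Local Notation M_ := 'M[K]_n.+1.
Variable X : 'I_m.+1 -> M_.
Hypothesis repX : forall i, rep 1 'X_i (X i).

Lemma rep_comm a a' A A' : a \is 1.-homog -> a' \is 1.-homog ->
  rep 1 a A -> rep 1 a' A' -> A * A' = A' * A.
Proof.
move=> ha ha' rA rA'; apply: (rep_uniq (s := 2) (dhomogM ha ha')); first exact: (rep_mul ha rA rA').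
rewrite mulrC; exact: (rep_mul ha' rA' rA).
Qed.

Lemma rep_sum (J : Type) (s : seq J) d (c : J -> K) (f : J -> T) (A : J -> M_) :
  (forall i, f i \is d.-homog) -> (forall i, rep d (f i) (A i)) ->
  rep d (\sum_(i <- s) c i *: f i) (\sum_(i <- s) c i *: A i).
Proof.
move=> hf rA; elim: s => [|i s IH]; first by rewrite !big_nil; apply: rep0; case: iI.
rewrite !big_cons; apply: rep_lin => //.
by apply: rpred_sum => k _; rewrite rpredZ.
Qed.

Lemma rep_lform y : rep 1 (lform y) (\sum_i y 0 i *: X i).
Proof. by apply: rep_sum => i; [rewrite dhomogX /= mdeg1|apply: repX]. Qed.

Lemma rep_prod (J : Type) (s : seq J) (f : J -> T) (A : J -> M_) :
  (forall i, f i \is 1.-homog) -> (forall i, rep 1 (f i) (A i)) ->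
  rep (size s) (\prod_(i <- s) f i) (\prod_(i <- s) A i).
Proof.
move=> hf rA; elim: s => [|i s IH]; first by rewrite !big_nil -[X in rep _ X](expr0 t); apply: rep1.
by rewrite !big_cons /= -add1n; apply: rep_mul.
Qed.

Let U := <<[seq X i | i <- enum 'I_m.+1]>>%VS.
Definition gen_alg : {vspace M_} := agenv U.
Local Notation V := gen_alg.

Lemma gen_X_mem i : X i \in V.
Proof. by apply: (subvP (sub_agenv U)); apply/memv_span/map_f; rewrite mem_enum. Qed.

Lemma gen_mul_mem A B : A \in V -> B \in V -> A * B \in V.
Proof. by move=> AV BV; rewrite /V -agenvM memv_mul. Qed.

Lemma gen_one_mem : 1 \in V.
Proof. by rewrite memvE sub1_agenv. Qed.

Lemma gen_prod (J : eqType) (s : seq J) (A : J -> M_) : (forall i, i \in s -> A i \in V) ->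
  \prod_(i <- s) A i \in V.
Proof.
move=> AV; rewrite big_seq; apply: (big_ind (fun x => x \in V)) => //; [exact: gen_one_mem|].
by move=> B C; apply: gen_mul_mem.
Qed.

Lemma span_sub (s : seq M_) (W : {vspace M_}) : (forall x, x \in s -> x \in W) -> (<<s>> <= W)%VS.
Proof. by move=> H; apply/span_subvP. Qed.

Lemma gen_alg_sub_cent W : (U <= 'C(W))%VS -> (V <= 'C(W))%VS.
Proof.
move=> UW; apply: agenv_sub_modl; first by rewrite -memvE centv1.
by apply/prodvP => x y /(subvP UW) xW yW; apply: memvM.
Qed.

Lemma gen_comm : {in V &, commutative *%R}.
Proof.
suff : (V <= 'C(V))%VS by move/centvsP.
apply: gen_alg_sub_cent; rewrite centvC; apply: gen_alg_sub_cent.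
apply: span_sub => _ /mapP[i _ ->]; rewrite -subv_cent1.
apply: span_sub => _ /mapP[k _ ->]; apply/cent1vP.
have hX l : ('X_l : T) \is 1.-homog by rewrite dhomogX /= mdeg1.
exact: (rep_comm (hX k) (hX i) (@repX k) (@repX i)).
Qed.

Lemma rep_gen d f : f \is d.-homog -> exists2 A, A \in V & rep d f A.
Proof.
move=> /dhomogP hf.
have Hm mn : mdeg mn = d -> rep d 'X_[mn] (\prod_(i <- m2s mn) X i).
  move=> <-; rewrite -size_m2s -[X in rep _ 'X_[X]](s2mK mn) mpolyX_s2m; apply: rep_prod => // i.
  by rewrite dhomogX /= mdeg1.
have H (s : seq 'X_{1..m.+1}) : {subset s <= msupp f} ->
    exists2 A, A \in V & rep d (\sum_(mn <- s) f@_mn *: 'X_[mn]) A /\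
       (\sum_(mn <- s) f@_mn *: 'X_[mn] \is d.-homog).
  elim: s => [|mn s IH] sf.
    exists 0; first exact: mem0v.
    by rewrite big_nil; split; [apply: rep0; case: iI|apply: dhomog0].
  have [|A AV [rA hA]] := IH; first by move=> x xs; apply: sf; rewrite inE xs orbT.
  have dmn : mdeg mn = d by apply/hf/sf/mem_head.
  have hmn : 'X_[K, mn] \is d.-homog by rewrite dhomogX; apply/eqP.
  exists (f@_mn *: (\prod_(i <- m2s mn) X i) + A).
    by rewrite rpredD ?rpredZ // gen_prod // => i _; apply: gen_X_mem.
  rewrite big_cons; split; last by rewrite rpredD ?rpredZ.
  by apply: rep_lin => //; apply: Hm.
have [//|A AV [rA _]] := H (msupp f).
by exists A => //; rewrite [f]mpolyE.
Qed.

Let one := crd (t ^+ j).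
Let htj : t ^+ j \is j.-homog := homog_exp j ht.

Lemma rep_one f A : f \is j.-homog -> rep j f A -> one *m A = crd f.
Proof.
move=> hf rA; apply: rA => //; rewrite mulrC subrr; by case: iI.
Qed.

Lemma rep_one_lt d f A : (d <= j)%N -> f \is d.-homog -> rep d f A ->
  one *m A = crd (t ^+ (j - d) * f).
Proof.
move=> le hf rA; apply: rA => //.
  by rewrite -{2}(subnK le) dhomogM // homog_exp.
by rewrite mulrA -exprD subnKC // mulrC subrr; case: iI.
Qed.

(** The vector of [t^j], which stands for the unit, is cyclic for the algebra. *)
Lemma gen_cyclic u : exists f A, [/\ f \is j.-homog, A \in V, rep j f A, crd f = u & one *m A = u].
Proof.
have [f hf <-] := crd_surj u; have [A AV rA] := rep_gen hf.
by exists f, A; split=> //; apply: rep_one.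
Qed.

Lemma gen_faithful A : A \in V -> one *m A = 0 -> A = 0.
Proof.
move=> AV oA; apply/row_matrixP => i; rewrite rowE row0.
have [f [B [_ BV _ _ <-]]] := gen_cyclic (delta_mx 0 i).
by rewrite -mulmxA [B *m A](gen_comm BV AV) -[A * B]/(A *m B) mulmxA oA mul0mx.
Qed.

(** An element of a commutative algebra is determined by its value on a cyclic
    vector. *)
Lemma gen_dim : (\dim V <= n.+1)%N.
Proof.
pose f : 'Hom(M_, 'rV[K]_n.+1) := linfun (mulmx one).
have : (\dim (f @: V) <= n.+1)%N.
  by apply: leq_trans (dimvS (subvf _)) _; rewrite dimvf /dim /= mul1n.
rewrite limg_dim_eq //; apply/eqP; rewrite -subv0; apply/subvP => A.
rewrite memv_cap memv_ker lfunE /= memv0 => /andP[AV /eqP oA].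
by rewrite (gen_faithful AV oA).
Qed.

Variable beta : {linear 'rV[K]_n.+1 -> K^o}.
Hypothesis phibeta : forall f, f \is j.-homog -> phi (t ^+ j * f) = beta (crd f).

Lemma cyclic_form_linear : linear (fun A : M_ => beta (one *m A)).
Proof. by move=> a A B; rewrite linearP linearP. Qed.

Definition cyclic_form : 'Hom(M_, K^o) := linfun (mk_linear cyclic_form_linear).

Lemma cyclic_formE A : cyclic_form A = beta (one *m A).
Proof. by rewrite lfunE. Qed.

(** This holds as the radical of [phi] has been divided out. *)
Lemma gen_nondeg A : A \in V -> (forall B, B \in V -> cyclic_form (A * B) = 0) -> A = 0.
Proof.
move=> AV HA; apply: gen_faithful => //.
have [f hf Ef] := crd_surj (one *m A); rewrite -Ef; apply/crd_ker => // g hg.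
have [B BV rB] := rep_gen hg.
have [|h hh Ih] := @divide_j j (g * f); first exact: dhomogM.
have := rB f h hf hh Ih; rewrite Ef => oAB.
have -> : phi (f * g) = phi (t ^+ j * h).
  apply/eqP; rewrite eq_sym -subr_eq0 -linearB; apply/eqP/phiI.
    by rewrite rpredB ?dhomogM.
  by rewrite [f * g]mulrC.
by rewrite phibeta // -oAB -mulmxA -cyclic_formE HA.
Qed.

Let Y i := X i - (z i)%:A.
Let UY := <<[seq Y i | i <- enum 'I_m.+1]>>%VS.
Definition gen_nil := (UY * V)%VS.
Local Notation N := gen_nil.

Lemma nil_mem i : Y i \in V.
Proof. by rewrite rpredB ?gen_X_mem // rpredZ // gen_one_mem. Qed.

Lemma span_nil_sub : (UY <= V)%VS.
Proof. by apply: span_sub => _ /mapP[i _ ->]; apply: nil_mem. Qed.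

Lemma gen_alg_mul : (V * V <= V)%VS. Proof. by rewrite /V agenvM. Qed.

Lemma span_nil_comm k : (V * UY ^+ k <= UY ^+ k * V)%VS.
Proof.
have sub : (UY ^+ k <= V)%VS.
  by apply: subv_trans (expvS k span_nil_sub) _;
     case: k => [|k]; rewrite ?expv0 ?sub1_agenv // /V agenvX.
apply/prodvP => A B AV BU; rewrite gen_comm ?memv_mul //; exact: (subvP sub).
Qed.

Let a i : T := 'X_i - z i *: t.
Let ha i : a i \is 1.-homog. Proof. by rewrite rpredB ?rpredZ // dhomogX /= mdeg1. Qed.

Lemma rep_nil i : rep 1 (a i) (Y i).
Proof.
rewrite /a /Y addrC [X i - _]addrC -scaleNr -scaleNr; apply: rep_lin => //.
  by rewrite dhomogX /= mdeg1.
by rewrite -[t in rep _ t]expr1; apply: rep1.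
Qed.

(** A long product of the forms [a i] contains a high power of one of them, and it
    is in [I]; so the corresponding product of matrices is 0. *)
Lemma prod_nil_eq0 : exists k, forall s : seq 'I_m.+1, size s = k -> \prod_(i <- s) Y i = 0.
Proof.
have [kk Hkk] := fin_choice nil; pose k0 := \max_i kk i.
exists (m.+1 * k0).+1 => s ss.
have [|i le_i] := @large_summand m.+1 (fun i => count_mem i s) k0.
  by rewrite sum_count_mem ss.
have Ia : I (\prod_(i <- s) a i).
  rewrite (bigID (pred1 i)) /=; apply: ideal_mulr => //.
  rewrite (eq_bigr (fun _ => a i)) => [|k /eqP -> //].
  have le_ki : (kk i <= count_mem i s)%N by apply: leq_trans le_i; apply: leq_bigmax.
  rewrite big_const_seq iter_mulr_1 -(subnK le_ki) exprD; case: iI => _ _; apply.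
  exact: Hkk.
have hs : \prod_(i <- s) a i \is (size s).-homog.
  by elim: (s) => [|k r IH]; rewrite ?big_nil ?dhomog1 // big_cons (dhomogM (ha k)).
apply: (rep_uniq hs); first by apply: rep_prod => // k; apply: rep_nil.
exact: rep0.
Qed.

Lemma span_nil_nilpotent : exists k, (UY ^+ k.+1 = 0)%VS.
Proof.
have [k Hk] := prod_nil_eq0; exists k.
have H i (s : seq 'I_m.+1) A : (size s + i = k.+1)%N -> A \in (UY ^+ i)%VS ->
    (\prod_(i <- s) Y i) * A = 0.
  elim: i s A => [|i IH] s A.
    rewrite addn0 expv0 => ss /vlineP[c ->]; rewrite -scalerAr mulr1.
    case: s ss => // x s [ss]; rewrite big_cons Hk // mulr0 scaler0 //.
  rewrite addnS => ss; set P := \prod_(i <- s) Y i.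
  suff /subvP H : (UY ^+ i.+1 <= lker (amull P))%VS.
    by move/H; rewrite memv_ker lfunE => /eqP.
  rewrite expvSl; apply/prodvP => u B uU BU.
  rewrite memv_ker lfunE /= mulrA; apply/eqP.
  suff /subvP/(_ _ uU) : (UY <= lker (amulr B \o amull P))%VS.
    by rewrite memv_ker comp_lfunE !lfunE /= => /eqP.
  apply: span_sub => _ /mapP[x _ ->]; rewrite memv_ker comp_lfunE !lfunE /=.
  have -> : P * Y x = \prod_(i <- rcons s x) Y i by rewrite -cats1 big_cat big_seq1.
  apply/eqP; apply: (IH (rcons s x)) => //; by rewrite size_rcons addSn.
apply/eqP; rewrite -subv0; apply/subvP => A /(H k.+1 [::]).
by rewrite big_nil mul1r memv0 add0n => ->.
Qed.

(** The nilpotent matrices [Y i] are the variables translated to the support;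
    together with the unit they generate the algebra. *)
Lemma gen_gorenstein : local_gorenstein V N cyclic_form.
Proof.
have NV : (N <= V)%VS by apply: subv_trans (prodvSl _ span_nil_sub) gen_alg_mul.
split.
- exact: gen_comm.
- split=> //; apply/eqP; rewrite eqEsubv subv_add NV -memvE gen_one_mem !andbT.
  apply: agenv_sub_modl; first exact: addvSl.
  apply/prodvP => u w uU wW.
  have wV : w \in V by move: w wW; apply/subvP; rewrite subv_add NV -memvE gen_one_mem.
  suff /subvP/(_ _ uU) : (U <= (amulr w @^-1: (<[1]> + N)))%VS by rewrite -memv_preim lfunE.
  apply: span_sub => _ /mapP[i _ ->]; rewrite -memv_preim lfunE /=.
  rewrite -[X i](subrK (z i)%:A) mulrDl rpredD //.
    apply: (subvP (addvSr _ _)); apply: memv_mul => //.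
    by apply/memv_span/map_f; rewrite mem_enum.
  by rewrite -scalerAl mul1r rpredZ.
- rewrite /N -!prodvA prodvSr // prodvA; apply: subv_trans gen_alg_mul; apply: prodvSl.
  by apply: subv_trans gen_alg_mul; apply: prodvSr; exact: span_nil_sub.
- have [k Hk] := span_nil_nilpotent; exists k; apply/eqP; rewrite -subv0.
  suff H i : (N ^+ i.+1 <= UY ^+ i.+1 * V)%VS by rewrite (subv_trans (H k)) // Hk prod0v subvv.
  elim: i => [|i IH]; first by rewrite !expv1.
  rewrite expvSl; apply: subv_trans (prodvSr _ IH) _.
  rewrite /N -prodvA [(V * _)%VS]prodvA.
  apply: subv_trans (prodvSr _ (prodvSl _ (span_nil_comm _))) _.
  by rewrite -prodvA prodvA -expvSl prodvSr // gen_alg_mul.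
- exact: gen_nondeg.
Qed.

End Rep.

(** * Decompositions carried by a local scheme *)

Section Local.
Variables (K : closedFieldType) (charK0 : [pchar K] =i pred0) (m d : nat) (hd : (4 <= d)%N).
Local Notation T := {mpoly K[m.+1]}.
Variables (Z : subscheme K m) (v0 : 'rV[K]_m.+1).
Hypothesis v0n : v0 != 0.
Hypothesis Hs : forall p, supp Z p <-> pline p = <[v0]>%VS.
Let I := sideal Z.
Let iI : ideal I := sideal_ideal Z.
Variables (b e0 : nat).
Hypothesis b5 : (b <= 5)%N.
Hypothesis HF : forall e, (e0 <= e)%N -> graded_coords I e b.

(** The form [L] is extended to a large degree along multiplication by [t], where
    the graded quotients have stabilized; the matrix algebra that it defines
    has dimension at most [b].  A linear form [u] of a decomposition of the
    algebra is the point with coordinates [u (X i)], which lies in the span of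
    the scheme as linear forms in [I] act by 0. *)
Lemma local_waring (L : {linear T -> K^o}) :
  (forall f, f \is d.-homog -> I f -> L f = 0) ->
  exists cv : seq (K * 'rV[K]_m.+1), [/\ (size cv <= (b.-1 * d.-1).+1)%N,
    forall y, I (lform y) -> forall a, a \in cv -> (lform y).@[a.2 0] = 0 &
    forall f, f \is d.-homog -> L f = \sum_(a <- cv) a.1 * f.@[a.2 0]].
Proof.
move=> HL; have /rV0Pn[i0 vi0] := v0n.
pose t : T := 'X_i0; have ht : t \is 1.-homog by apply: X_homog.
have tl : t = lform (delta_mx 0 i0) by rewrite lform_delta.
have HFb : graded_coords I (maxn e0 b) b by apply: HF; apply: leq_maxl.
have bb : (b <= maxn e0 b)%N by apply: leq_maxr.
have reg f : I (t * f) -> I f.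
  rewrite tl; apply: (nonvanishing_regular HFb bb) => p /Hs Ep.
  have vp : v0 \in pline p by rewrite Ep memv_line.
  by move/(_ v0 vp); rewrite -tl mevalXU; apply/eqP.
pose z i := v0 0 i / v0 0 i0.
have nil i : exists k, I (('X_i - z i *: t) ^+ k).
  have E : lform (delta_mx 0 i - z i *: delta_mx 0 i0) = 'X_i - z i *: t.
    by rewrite addrC -scaleNr lform_linear !lform_delta scaleNr addrC.
  rewrite -E; apply: (vanishing_nilpotent HFb bb) => p /Hs Ep.
  have vp : v0 \in pline p by rewrite Ep memv_line.
  apply/(vanishes_homog (lform_homog _) vp v0n).
  by rewrite E mevalB mevalZ !mevalXU divfK ?subrr.
(* The forms of degree [j] carry the algebra; [phi] lives in degree [j + j]. *)
pose j := (maxn e0 d).+1.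
have le_e0j : (e0 < j)%N by rewrite ltnS leq_maxl.
have le_dj : (d <= j)%N by rewrite leqW // leq_maxr.
have [cE [cEk cEs]] := HF (leq_trans (ltnW le_e0j) (leq_addr j j)).
have [||mu Hmu] := @factor_coordinates K T b (cE \o mulby (t ^+ (j + j - d)))
    (fun f => f \is d.-homog) L.
- exact: homog_lin_closed.
- move=> f hf /= Hc; apply: HL => //; apply: (reg_exp reg (s := j + j - d)); apply/cEk => //.
  by rewrite -{2}(subnK (leq_trans le_dj (leq_addr j j))) dhomogM // homog_exp.
have philin : linear (fun f => mu (cE f)) by move=> a f g; rewrite !linearP.
have [phi Ephi] : exists phi : {linear T -> K^o}, forall f, phi f = mu (cE f).
  by exists (mk_linear philin).
have phiI f : f \is (j + j).-homog -> I f -> phi f = 0.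
  by move=> hf If; rewrite Ephi (cEk f hf).2 // linear0.
have phiL f : f \is d.-homog -> phi (t ^+ (j + j - d) * f) = L f.
  by move=> hf; rewrite Ephi Hmu.
have lrad : lin_closed (radical_form j phi).
  split=> [g hg|a f g rf rg h hh]; first by rewrite mul0r linear0.
  by rewrite mulrDl -scalerAl linearP /= rf // rg // scaler0 addr0.
have [n' Hc2] := graded_coords_exists j lrad.
have le_n'b : (n' <= b)%N.
  have [||//] := @graded_dim_le K m (radical_form j phi) I j j n' b (idfun : {linear T -> T}) Hc2 (HF (ltnW le_e0j)).
  - by [].
  - move=> f hf If g hg; apply: phiI; first exact: dhomogM.
    exact: ideal_mulr.
have htj := homog_exp j ht.
case: n' Hc2 le_n'b => [|n] [crd [crd_ker crd_surj]] le_nb.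
  exists [::]; split=> // f hf; rewrite big_nil -phiL //.
  have hf' : t ^+ (j - d) * f \is j.-homog.
    by rewrite -{2}(subnK le_dj) dhomogM // homog_exp.
  have rf' : radical_form j phi (t ^+ (j - d) * f).
    by apply/crd_ker => //; apply: thinmx0.
  by rewrite -addnBA // exprD -mulrA mulrC rf'.
have [X repX] := fin_choice (fun i =>
   rep_exists ht reg HF le_e0j phiI crd_ker crd_surj (X_homog K i)).
have [||beta Hbeta] := @factor_coordinates K T n.+1 crd (fun f => f \is j.-homog)
    (mk_linear (fun a f g => linearP (phi \o mulby (t ^+ j)) a f g)).
- exact: homog_lin_closed.
- by move=> f hf /(crd_ker f hf) rf /=; rewrite /mulby mulrC; apply: rf.
have phibeta f : f \is j.-homog -> phi (t ^+ j * f) = beta (crd f).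
  by move=> hf; rewrite -Hbeta.
have G := gen_gorenstein ht reg HF le_e0j phiI crd_ker crd_surj nil repX phibeta.
have dV := gen_dim ht reg HF le_e0j phiI crd_ker crd_surj repX.
have [cu [scu Hcu]] := gorenstein_waring charK0 hd G (leq_trans dV (leq_trans le_nb b5)).
pose pt (u : 'Hom('M[K]_n.+1, K^o)) : 'rV[K]_m.+1 := \row_i u (X i).
have ptE u y : (lform y).@[pt u 0] = u (\sum_i y 0 i *: X i).
  rewrite lform_eval linear_sum; apply: eq_bigr => i _.
  by rewrite mxE linearZ.
exists [seq (a.1, pt a.2) | a <- cu]; split.
- rewrite size_map; apply: leq_trans scu _; rewrite ltnS leq_mul2r; apply/orP; right.
  move: dV le_nb; move: (\dim _) => x; lia.
- move=> y Iy _ /mapP[a _ ->] /=; rewrite ptE.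
  have rl : rep Z t j crd 1 (lform y) (\sum_i y 0 i *: X i).
    exact: (rep_lform ht reg HF le_e0j phiI crd_ker repX).
  have r0 : rep Z t j crd 1 (lform y) 0 by exact: (rep0 reg phiI crd_ker Iy).
  by rewrite (rep_uniq ht reg HF le_e0j crd_surj (lform_homog y) rl r0) linear0.
- have Hm mn : mdeg mn = d -> L 'X_[mn] = \sum_(a <- cu) a.1 * 'X_[K, mn].@[pt a.2 0].
    move=> dmn; pose s := m2s mn; have ss : size s = d by rewrite size_m2s.
    have hmn : 'X_[K, mn] \is d.-homog by rewrite dhomogX; apply/eqP.
    have rA : rep Z t j crd d 'X_[mn] (\prod_(i <- s) X i).
      rewrite -ss -(s2mK mn) mpolyX_s2m; apply: (rep_prod ht reg HF le_e0j phiI crd_ker _ repX).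
      by move=> i; rewrite X_homog.
    have hf' : t ^+ (j - d) * 'X_[mn] \is j.-homog.
      by rewrite -{2}(subnK le_dj) dhomogM // homog_exp.
    rewrite -phiL // -addnBA // exprD -mulrA phibeta //.
    rewrite -(rep_one_lt ht le_dj hmn rA) -cyclic_formE.
    have := Hcu [seq X i | i <- s]; rewrite size_map big_map => -> //; last first.
      by move=> _ /mapP[i _ ->]; apply: gen_X_mem.
    apply: eq_bigr => a _; congr (_ * _); rewrite big_map -[in RHS](s2mK mn) meval_s2m.
    by apply: eq_bigr => i _; rewrite mxE.
  move=> f /dhomogP hf; rewrite [in LHS](mpolyE f) linear_sum big_seq.
  under eq_bigr => mn mnf do rewrite linearZ /= (Hm mn (hf mn mnf)).
  rewrite -big_seq [in RHS]big_map /=.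
  transitivity (\sum_(a <- cu) \sum_(mn <- msupp f) a.1 * (f@_mn * 'X_[K, mn].@[pt a.2 0])).
    rewrite exchange_big; apply: eq_bigr => mn _; rewrite scaler_sumr; apply: eq_bigr => a _ /=.
    by rewrite mulrCA.
  apply: eq_bigr => a _; rewrite [in RHS](mpolyE f) raddf_sum mulr_sumr.
  by apply: eq_bigr => mn _; rewrite /= mevalZ.
Qed.
End Local.

(** * The lower bound for the rank *)

Section Eval.
Variables (K : fieldType) (m : nat).
Local Notation T := {mpoly K[m.+1]}.

Lemma ev_linear (v : 'rV[K]_m.+1) : linear (fun y => (lform y).@[v 0] : K^o).
Proof. by move=> a u w; rewrite lform_linear mevalD mevalZ. Qed.
Definition ev v : 'Hom('rV[K]_m.+1, K^o) := linfun (mk_linear (ev_linear v)).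
Lemma evE v y : ev v y = (lform y).@[v 0].
Proof. by rewrite lfunE. Qed.

(** Each [v] in [S] on which [N] does not vanish can be made a zero of [y0] at the
    cost of one dimension of [N]; what remains of [N] at the end vanishes on
    [S], and it is contained in [W]. *)
Lemma greedy (S : seq 'rV[K]_m.+1) (N W : {vspace 'rV[K]_m.+1}) (y0 : 'rV[K]_m.+1) :
  (forall y, y \in N -> (forall v, v \in S -> ev v y = 0) -> y \in W) ->
  exists2 a, a \in N & (\dim N <= \dim W + count (fun v => ev v (y0 - a)%R == 0%R) S)%N.
Proof.
elim: S N y0 => [|v S IH] N y0 HW.
  exists 0; first exact: mem0v.
  by rewrite addn0 dimvS //; apply/subvP => y yN; apply: HW.
have [/subvP Nv|/subvPn[b bN]] := boolP (N <= lker (ev v))%VS.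
  have [|a aN Ha] := IH N y0.
    move=> y yN HS; apply: HW => // u; rewrite inE => /predU1P[->|/HS //].
    by apply/eqP; rewrite -memv_ker Nv.
  by exists a => //; apply: leq_trans Ha _; rewrite leq_add2l /= leq_addl.
rewrite memv_ker => bv; pose y1 := y0 - (ev v y0 / ev v b) *: b.
have y1v : ev v y1 = 0 by rewrite linearB linearZ /= /GRing.scale /= divfK ?subrr.
have [|a] := IH (N :&: lker (ev v))%VS y1.
  move=> y; rewrite memv_cap memv_ker => /andP[yN /eqP yv] HS.
  by apply: HW => // u; rewrite inE => /predU1P[->|/HS].
rewrite memv_cap memv_ker => /andP[aN /eqP av] Ha.
exists (a + (ev v y0 / ev v b) *: b); first by rewrite rpredD ?rpredZ.
have -> : y0 - (a + (ev v y0 / ev v b) *: b) = y1 - a by rewrite opprD addrCA addrC.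
rewrite /= [ev v (y1 - a)]linearB /= y1v av subrr eqxx add1n addnS.
apply: leq_trans (dim_cap_lker N (ev v)) _; by rewrite ltnS.
Qed.

Lemma common_kernel (S : seq 'rV[K]_m.+1) : exists N : {vspace 'rV[K]_m.+1},
  (forall y v, y \in N -> v \in S -> ev v y = 0) /\ (m.+1 <= \dim N + size S)%N.
Proof.
elim: S => [|v S [N [HN dN]]]; first by exists fullv; split=> //; rewrite dimvf /dim /= mul1n addn0.
exists (N :&: lker (ev v))%VS; split.
  move=> y u; rewrite memv_cap memv_ker inE => /andP[yN /eqP yv] /predU1P[->|/HN] //; exact.
rewrite /= addnS; apply: leq_trans dN _; rewrite -addSn leq_add2r; exact: dim_cap_lker.
Qed.

End Eval.

Section Lower.
Variables (K : closedFieldType) (m : nat) (Z : subscheme K m).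
Local Notation T := {mpoly K[m.+1]}.
Let I := sideal Z.
Let iI : ideal I := sideal_ideal Z.
Variables (q : nat) (vs : seq 'rV[K]_m.+1) (U1 : {vspace 'rV[K]_m.+1}) (y0 : 'rV[K]_m.+1).
Hypothesis reg : forall y f, (forall v, v \in vs -> ev v y != 0) -> I (lform y * f) -> I f.
Hypothesis HF : forall e, (0 < e)%N -> graded_coords I e q.
Hypothesis HU1 : forall y, y \in U1 <-> I (lform y).
Hypothesis dU1 : (\dim U1 + q <= m.+1)%N.
Hypothesis Hy0 : forall v, v \in vs -> ev v y0 != 0.

(** The induction that removes [q - size vs] points of [S] in each degree: [y1]
    is nonzero on the support [vs], so that multiplication by [lform y1] is
    bijective modulo [I] and preserves nondegeneracy. *)
Lemma rank_lower_bound e (L : {linear T -> K^o}) (S : seq 'rV[K]_m.+1) :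
  (forall f, f \is e.+2.-homog -> I f -> L f = 0) ->
  (forall y, (forall g, g \is e.+1.-homog -> L (lform y * g) = 0) -> I (lform y)) ->
  (forall f, f \is e.+2.-homog -> (forall v, v \in S -> f.@[v 0] = 0) -> L f = 0) ->
  (q + (q - size vs) * e <= size S)%N.
Proof.
elim: e L S => [|e IH] L S HL nd HS.
  have [|a _] := @greedy K m S fullv U1 0.
    move=> y _ Hy; apply/HU1/nd => g hg; apply: HS; first exact: (dhomogM (lform_homog y) hg).
    by move=> v vS; rewrite mevalM -evE Hy // mul0r.
  rewrite dimvf /dim /= mul1n muln0 addn0 => H.
  have := count_size (fun v => ev v (0 - a) == 0) S.
  move: H dU1; move: (\dim U1) (count _ _) (size S) => x y z h1 h2 h3.
  rewrite -(leq_add2l x) (leq_trans h2) // (leq_trans h1) // leq_add2l //.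
have [N [HN dN]] := common_kernel vs.
have [|a aN Ha] := @greedy K m S N U1 y0.
  move=> y _ Hy; apply/HU1/nd => g hg; apply: HS; first exact: (dhomogM (lform_homog y) hg).
  by move=> v vS; rewrite mevalM -evE Hy // mul0r.
pose y1 := y0 - a; pose u := lform y1.
have hu : u \is 1.-homog := lform_homog y1.
have y1v v : v \in vs -> ev v y1 != 0.
  by move=> vvs; rewrite linearB /= [ev v a](HN _ _ aN vvs) subr0 Hy0.
have regu f : I (u * f) -> I f by apply: reg.
have L'lin : linear (fun f => L (u * f)) by move=> x f g; rewrite mulrDr -scalerAr linearP.
have H : (q + (q - size vs) * e <= size [seq v <- S | ev v y1 != 0%R])%N;
  first apply: (IH (mk_linear L'lin)) => /=.
- move=> f hf If; apply: HL; first exact: (dhomogM hu hf).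
  by have [_ _ IM] := iI; apply: IM.
- move=> y Hy; apply: nd => h hh.
  have [||_ Hdiv] := @graded_dim_le K m I I e.+1 e.+2 q q (mulby u) (HF (ltn0Sn _)) (HF (ltn0Sn _)).
  + by move=> f hf; exact: (dhomogM hu hf).
  + by move=> f _ /regu.
  have [//||g hg Ig] := Hdiv _ _ h hh; first exact: ideal_lin.
  have : L (lform y * (mulby u g - h)) = 0.
    apply: HL; last by have [_ _ IM] := iI; apply: IM.
    by apply: (dhomogM (lform_homog y)); rewrite rpredB //; exact: (dhomogM hu hg).
  rewrite mulrBr linearB /= => /eqP; rewrite subr_eq0 => /eqP <-.
  by rewrite /mulby mulrCA Hy.
- move=> f hf HfS; apply: HS; first exact: (dhomogM hu hf).
  move=> v vS; rewrite mevalM -evE; have [->|n0] := eqVneq (ev v y1) 0; first by rewrite mul0r.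
  by rewrite HfS ?mulr0 // mem_filter n0.
move: H; rewrite size_filter => H; rewrite mulnS addnCA.
have := count_predC (fun v => ev v y1 == 0%R) S.
move: H Ha dU1 dN; rewrite /predC -/y1.
move: (\dim U1) (\dim N) => x1 x2 H1 H2 H3 H4 <-; apply: leq_add H1; rewrite leq_subLR.
rewrite -(leq_add2l x1) (leq_trans H3) // (leq_trans H4) // addnCA addnC leq_add2l.
exact: H2.
Qed.

End Lower.

(** * Linear forms on the space of forms of degree d *)

(** A subspace is the intersection of the hyperplanes that contain it. *)
Lemma separate (K : fieldType) n (W : {vspace 'rV[K]_n}) w : w \notin W ->
  exists u : 'rV[K]_n, (forall x, x \in W -> \sum_i u 0 i * x 0 i = 0) /\
    \sum_i u 0 i * w 0 i != 0.
Proof.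
move=> wW; have dW : (\dim W + (\dim {:'rV[K]_n} - \dim W) = \dim {:'rV[K]_n})%N.
  by rewrite subnKC // dimvS ?subvf.
have [c [ck _]] := coordinates_mod dW.
have : c w != 0 by apply: contraNneq wW => /ck.
case/rV0Pn => k cwk; pose u : 'rV[K]_n := \row_i c (delta_mx 0 i) 0 k.
have uE (x : 'rV[K]_n) : \sum_i u 0 i * x 0 i = c x 0 k.
  rewrite {2}[x]row_sum_delta linear_sum summxE; apply: eq_bigr => i _.
  by rewrite linearZ !mxE mulrC.
by exists u; split=> [x /ck cx|]; rewrite uE // cx mxE.
Qed.

Lemma vspace_extend (K : fieldType) (vT : vectType K) (U : {vspace vT}) k :
  (\dim U <= k <= \dim {:vT})%N -> exists2 W : {vspace vT}, (U <= W)%VS & \dim W = k.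
Proof.
case/andP => le1 le2; have [r Er] : exists r, (k = \dim U + r)%N.
  by exists (k - \dim U)%N; rewrite subnKC.
elim: r U {le1} Er => [|r IH] U Er; first by exists U; rewrite // Er addn0.
have : ~~ (fullv <= U)%VS.
  by apply/negP => /dimvS; move: Er le2; move: (\dim U) (\dim _) => x y; lia.
case/subvPn => v _ vU.
have [|W UW dW] := IH (U + <[v]>)%VS; last by exists W => //; apply: subv_trans UW; apply: addvSl.
by rewrite dim_addv_line // Er addSnnS.
Qed.

Section Veronese.
Variables (K : fieldType) (m d : nat).
Local Notation r := (vdim m d).
Local Notation T := {mpoly K[m.+1]}.

Lemma vmon_deg (j : 'I_r.+1) : mdeg (vmon j) = d.
Proof. by apply/eqP; rewrite basis_cover mem_nth // -/(vmonomials m d) size_vmonomials. Qed.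

Lemma vmon_inj : injective (@vmon m d).
Proof.
move=> i j /eqP; rewrite /vmon nth_uniq ?size_vmonomials //; last exact: uniq_basis.
by move/eqP/val_inj.
Qed.

Lemma vmon_surj mn : mdeg mn = d -> exists j : 'I_r.+1, mn = vmon j.
Proof.
move/eqP; rewrite basis_cover -/(vmonomials m d) => mnb.
have lt : (index mn (vmonomials m d) < r.+1)%N by rewrite -size_vmonomials index_mem.
by exists (Ordinal lt); rewrite /vmon nth_index.
Qed.

(** The forms of degree [d], in the coordinates of the Veronese embedding. *)
Definition form_of (u : 'rV[K]_r.+1) : T := \sum_j u 0 j *: 'X_[vmon j].

Lemma form_of_linear : linear form_of.
Proof.
move=> a u v; rewrite /form_of scaler_sumr -big_split; apply: eq_bigr => i _ /=.
by rewrite !mxE scalerDl scalerA.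
Qed.

Lemma form_of_homog u : form_of u \is d.-homog.
Proof. by apply: rpred_sum => j _; rewrite rpredZ // dhomogX; apply/eqP/vmon_deg. Qed.

Lemma form_of_coeff u j : (form_of u)@_(vmon j) = u 0 j.
Proof.
rewrite raddf_sum (bigD1 j) //= big1 => [|i ij]; first by rewrite mcoeffZ mcoeffX eqxx mulr1 addr0.
by rewrite mcoeffZ mcoeffX (inj_eq vmon_inj) (negPf ij) mulr0.
Qed.

Lemma form_of_eval u (v : 'rV[K]_m.+1) : (form_of u).@[v 0] = \sum_j u 0 j * vvec d v 0 j.
Proof.
rewrite raddf_sum; apply: eq_bigr => j _ /=; by rewrite mevalZ mevalX mxE.
Qed.

Lemma form_ofK f : f \is d.-homog -> form_of (\row_j f@_(vmon j)) = f.
Proof.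
move=> hf; apply/mpolyP => mn; have [e|ne] := eqVneq (mdeg mn) d.
  by have [j ->] := vmon_surj e; rewrite form_of_coeff mxE.
rewrite (dhomog_nemf_coeff (d := d) (mf := mdeg)) ?form_of_homog //.
by rewrite (dhomog_nemf_coeff (d := d) (mf := mdeg)).
Qed.

Lemma pullback_lform u : veronese_pullback (lform u) = form_of u.
Proof.
rewrite /veronese_pullback /lform raddf_sum; apply: eq_bigr => j _ /=.
by rewrite comp_mpolyZ comp_mpolyXU -tnth_nth tnth_mktuple.
Qed.

Variable P : pspace K r.
Let w := vpick (pline P).

Lemma span_linear : linear (fun f : T => \sum_j f@_(vmon j) * w 0 j : K^o).
Proof.
move=> a f g; rewrite scaler_sumr -big_split; apply: eq_bigr => j _ /=.
by rewrite mcoeffD mcoeffZ mulrDl -mulrA.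
Qed.
(** The linear form on [T_d] defined by [P]; it depends on the representative
    [w] only by a scalar. *)
Definition eval_at : {linear T -> K^o} := mk_linear span_linear.

Lemma eval_at_form u : eval_at (form_of u) = \sum_j u 0 j * w 0 j.
Proof. by apply: eq_bigr => j _; rewrite form_of_coeff. Qed.

Lemma eval_at_neq0 : exists2 f, f \is d.-homog & eval_at f != 0.
Proof.
have /rV0Pn[j wj] := pline_pick P; exists 'X_[vmon j].
  by rewrite dhomogX; apply/eqP/vmon_deg.
rewrite /eval_at /= (bigD1 j) //= big1 ?addr0 => [|i ij]; first by rewrite mcoeffX eqxx mul1r.
by rewrite mcoeffX (inj_eq vmon_inj) eq_sym (negPf ij) mul0r.
Qed.

Lemma pline_sub (W : {vspace 'rV[K]_r.+1}) : (pline P <= W)%VS = (w \in W).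
Proof. by rewrite (pline_line (memv_pick _) (pline_pick P)) -memvE. Qed.

Lemma in_spanP (S : {fset pspace K m}) : in_veronese_span S P <->
  forall f, f \is d.-homog -> (forall p, p \in S -> vanishes_at f p) -> eval_at f = 0.
Proof.
split=> [H f hf fS|H W HW].
  have lin : linear (fun x : 'rV[K]_r.+1 => \sum_j f@_(vmon j) * x 0 j : K^o).
    move=> a x y; rewrite scaler_sumr -big_split; apply: eq_bigr => j _ /=.
    by rewrite !mxE mulrDr mulrCA.
  have [G GE] : exists G : 'Hom('rV[K]_r.+1, K^o), forall x, G x = \sum_j f@_(vmon j) * x 0 j.
    by exists (linfun (mk_linear lin)) => x; rewrite lfunE.
  have := H (lker G); rewrite pline_sub memv_ker GE => HH.
  apply/eqP/HH => q [p pS ->].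
  rewrite -memvE memv_ker GE; have := fS p pS _ (memv_pick _).
  rewrite -{1}(form_ofK hf) form_of_eval => E; rewrite -[X in _ == X]E; apply/eqP.
  by apply: eq_bigr => j _; rewrite [in RHS]mxE.
rewrite pline_sub; apply: contraT => /separate[u [uW uw]]; case/negP: uw; apply/eqP.
rewrite -eval_at_form; apply: H; first exact: form_of_homog.
move=> p pS; apply/(vanishes_homog (form_of_homog u) (memv_pick _) (pline_pick p)).
rewrite form_of_eval; apply: uW; rewrite memvE.
by apply: (HW (veronese d p)); exists p.
Qed.

(** The direct implication uses the subspace orthogonal to all the forms of degree
    [d] in the ideal, whose orthogonal is again this space of forms. *)
Lemma in_scheme_spanP (Z : subscheme K m) : in_veronese_scheme_span Z P <->
  forall f, f \is d.-homog -> sideal Z f -> eval_at f = 0.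
Proof.
have iI := sideal_ideal Z; have [I0 _ _] := iI.
have lU : lin_closed (fun u => sideal Z (form_of u)).
  split=> [|a u v Iu Iv]; first by rewrite /form_of big1 // => j _; rewrite mxE scale0r.
  by rewrite form_of_linear; apply: (ideal_lin iI).2.
have [U HU] := vspace_of_pred lU.
split=> [H f hf If|H W HW].
  have [|W HW] := @vspace_of_pred K _ (fun x : 'rV[K]_r.+1 =>
     forall u, u \in U -> \sum_j u 0 j * x 0 j = 0).
    split=> [u _|a x y Hx Hy u uU]; first by rewrite big1 // => j _; rewrite mxE mulr0.
    under eq_bigr => j _ do rewrite !mxE mulrDr mulrCA.
    by rewrite big_split /= -mulr_sumr Hx // Hy // mulr0 addr0.
  have := H W; rewrite pline_sub => /(_ _)/HW wW.
  rewrite -(form_ofK hf) eval_at_form; apply: wW; last by apply/HU; rewrite form_ofK.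
  move=> L /homog1_lform[u ->] HL; rewrite pullback_lform; apply/HU.
  apply: contraT => /separate[x [xU xu]]; case/negP: xu; apply/eqP.
  under eq_bigr do rewrite mulrC.
  rewrite -lform_eval; apply: HL; apply/HW => u' u'U; rewrite -[RHS](xU _ u'U).
  by apply: eq_bigr => j _; rewrite mulrC.
rewrite pline_sub; apply: contraT => /separate[u [uW uw]]; case/negP: uw; apply/eqP.
rewrite -eval_at_form; apply: H; first exact: form_of_homog.
rewrite -pullback_lform; apply: HW; first exact: lform_homog.
by move=> x xW; rewrite lform_eval uW.
Qed.

End Veronese.

(** Vectors that are 0 give no point, but a form of positive degree vanishes there. *)
Lemma points_of_vectors (K : fieldType) m d (cv : seq (K * 'rV[K]_m.+1)) : (0 < d)%N ->
  exists S : {fset pspace K m}, [/\ (#|` S| <= size cv)%N,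
   forall f, f \is d.-homog -> (forall p, p \in S -> vanishes_at f p) ->
     forall a, a \in cv -> f.@[a.2 0] = 0 &
   forall p, p \in S -> exists2 a, a \in cv & pline p = <[a.2]>%VS].
Proof.
move=> d0; elim: cv => [|a cv [S [sS HS pS]]].
  by exists fset0; split=> // [|p]; rewrite ?cardfs0 // in_fset0.
have [a0|a0] := eqVneq a.2 0.
  exists S; split=> [|f hf fS x|p /pS[x xcv Ex]]; first exact: leqW.
    rewrite inE => /predU1P[->|]; last exact: HS.
    by rewrite a0 -(scale0r 0) (homog_evalZ _ _ hf) expr0n eqn0Ngt d0 mul0r.
  by exists x; rewrite // inE xcv orbT.
have [p Ep] := point_of a0; exists (p |` S)%fset; split.
- by rewrite cardfsU1; exact: (leq_add (leq_b1 _) sS).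
- move=> f hf fS x; rewrite inE => /predU1P[->|].
    by apply: (fS p); rewrite ?fset1U1 // Ep memv_line.
  by apply: HS => // p' p'S; apply: fS; rewrite fset1Ur.
- move=> p'; rewrite in_fset1U => /orP[/eqP->|/pS[x xcv Ex]]; first by exists a; rewrite ?mem_head.
  by exists x; rewrite // inE xcv orbT.
Qed.

(** * Several components *)

Section Multi.
Variables (K : closedFieldType) (charK0 : [pchar K] =i pred0) (m d : nat) (hd : (4 <= d)%N).
Local Notation T := {mpoly K[m.+1]}.
Variables (s : nat) (A_ : 'I_s -> subscheme K m) (v_ : 'I_s -> 'rV[K]_m.+1).
Variables (b : 'I_s -> nat) (e_ : 'I_s -> nat).
Hypothesis v0 : forall i, v_ i != 0.
Hypothesis supp_v : forall i p, supp (A_ i) p <-> pline p = <[v_ i]>%VS.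
Hypothesis b5 : forall i, (b i <= 5)%N.
Hypothesis HF : forall i e, (e_ i <= e)%N -> graded_coords (sideal (A_ i)) e (b i).

(** [L] kills the intersection of two subspaces, so it is a sum of two forms that
    kill one of them each. *)
Lemma multi_waring (l : seq 'I_s) (L : {linear T -> K^o}) :
  (forall f, f \is d.-homog -> (forall i, i \in l -> sideal (A_ i) f) -> L f = 0) ->
  exists cv : seq (K * 'rV[K]_m.+1), [/\ (size cv <= \sum_(i <- l) ((b i).-1 * d.-1).+1)%N,
    forall y, (forall i, i \in l -> sideal (A_ i) (lform y)) ->
      forall a, a \in cv -> (lform y).@[a.2 0] = 0 &
    forall f, f \is d.-homog -> L f = \sum_(a <- cv) a.1 * f.@[a.2 0]].
Proof.
elim: l L => [|i l IH] L HL.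
  by exists [::]; split=> // f hf; rewrite big_nil; apply: HL.
have [c [ck cs]] := HF (leq_maxl (e_ i) d).
have [k [ci [cik cis]]] := graded_coords_exists d (ideal_lin (sideal_ideal (A_ i))).
have [||mu Hmu] := @factor_coordinates K T k ci
    (fun f => f \is d.-homog /\ forall i, i \in l -> sideal (A_ i) f) L.
- split=> [|a f g [hf Hf] [hg Hg]]; first by split=> [|k' _]; [apply: dhomog0|apply: sideal0].
  split=> [|k' kl]; first by rewrite rpredD ?rpredZ.
  by apply: (ideal_lin (sideal_ideal (A_ k'))).2; [apply: Hf|apply: Hg].
- move=> f [hf Hf] /(cik f hf) If; apply: HL => // k'.
  by rewrite inE => /predU1P[->|/Hf].
have L1lin : linear (fun f => mu (ci f)) by move=> a f g; rewrite !linearP.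
have [L1 EL1] : exists L1 : {linear T -> K^o}, forall f, L1 f = mu (ci f).
  by exists (mk_linear L1lin).
have L2lin : linear (fun f => L f - L1 f).
  by move=> a f g; rewrite (linearP L) (linearP L1) opprD addrACA scalerBr.
have [L2 EL2] : exists L2 : {linear T -> K^o}, forall f, L2 f = L f - L1 f.
  by exists (mk_linear L2lin).
(* [L1] agrees with [L] on the forms that are in the other ideals, so that
   [L2 = L - L1] kills them. *)
have [|cv1 [s1 z1 E1]] := @local_waring K charK0 m d hd (A_ i)
   (v_ i) (v0 i) (supp_v i) _ _ (b5 i) (@HF i) L1.
  by move=> f hf If; rewrite EL1 (cik f hf).2 // linear0.
have [|cv2 [s2 z2 E2]] := IH L2.
  by move=> f hf Hf; rewrite EL2 EL1 Hmu ?subrr.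
exists (cv1 ++ cv2); split.
- by rewrite size_cat big_cons leq_add.
- move=> y Hy a; rewrite mem_cat => /orP[]; first by apply: z1; apply: Hy; rewrite mem_head.
  by apply: z2 => k' kl; apply: Hy; rewrite inE kl orbT.
- by move=> f hf; rewrite big_cat /= -E1 // -E2 // EL2 addrC subrK.
Qed.

End Multi.

(** A finite union of hyperplanes does not cover the space. *)
Lemma nonvanishing_form (K : closedFieldType) (charK0 : [pchar K] =i pred0) m
  (l : seq 'rV[K]_m.+1) : (forall v, v \in l -> v != 0) ->
  exists y, forall v, v \in l -> ev v y != 0.
Proof.
elim: l => [|v l IH] Hl; first by exists 0.
have [|y Hy] := IH; first by move=> u ul; apply: Hl; rewrite inE ul orbT.
have [yv|yv] := eqVneq (ev v y) 0; last by exists y => u; rewrite inE => /predU1P[->|/Hy].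
have /rV0Pn[i vi] := Hl v (mem_head _ _).
pose x : 'rV[K]_m.+1 := delta_mx 0 i.
have xv : ev v x != 0 by rewrite evE lform_delta mevalXU.
have [c Hc] := exists_notin charK0 (0 :: [seq - ev u y / ev u x | u <- l]).
move: Hc; rewrite inE negb_or => /andP[c0 Hc].
exists (y + c *: x) => u; rewrite linearD linearZ /= inE => /predU1P[->|ul].
  by rewrite yv add0r mulf_neq0.
have [ux|ux] := eqVneq (ev u x) 0; first by rewrite ux scaler0 addr0 Hy.
apply: contra Hc => /eqP E; apply/mapP; exists u => //.
by apply: (mulIf ux); rewrite divfK //; apply/eqP; rewrite -addr_eq0 addrC; apply/eqP.
Qed.

Lemma codim_bigcap (K : fieldType) (vT : vectType K) (I : eqType) (l : seq I)
  (U : I -> {vspace vT}) (b : I -> nat) :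
  (forall i, i \in l -> (\dim (U i) + b i = \dim {:vT})%N) ->
  (\dim {:vT} <= \dim (\bigcap_(i <- l) U i) + \sum_(i <- l) b i)%N.
Proof.
elim: l => [|i l IH] H; first by rewrite !big_nil addn0.
have := IH (fun k kl => H k (mem_behead (kl : k \in behead (i :: l)))); rewrite !big_cons.
set W := (\bigcap_(j <- l) U j)%VS.
have := dimv_sum_cap (U i) W; have := dimvS (subvf (U i + W)); have := H i (mem_head _ _).
by move: (\dim _) (\dim _) (\dim _) (\dim _) (\dim _) (b i) (\sum_(j <- l) b j)%N => *; lia.
Qed.

Lemma hilbert_exists (K : fieldType) m (Z : subscheme K m) e : exists k, hilbert_fun Z e k.
Proof.
have [U HU] := dhomog_pred_vspace e (ideal_lin (sideal_ideal Z)).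
exists (\dim {:dhomog m.+1 K e} - \dim U)%N; exists U; split=> //.
by rewrite subnKC // dimvS ?subvf.
Qed.

Lemma graded_dim_uniq (K : fieldType) m (I : {mpoly K[m.+1]} -> Prop) e k k' :
  graded_coords I e k -> graded_coords I e k' -> k = k'.
Proof.
move=> H H'; apply/eqP; rewrite eqn_leq.
have [//||-> _] := @graded_dim_le K m I I e e k k' (idfun : {linear _ -> _}) H H'; first by [].
by have [//||-> _] := @graded_dim_le K m I I e e k' k (idfun : {linear _ -> _}) H' H.
Qed.

Lemma bounded_nondecreasing_stable (h : nat -> nat) B :
  (forall e, (0 < e)%N -> (h e <= h e.+1)%N) -> (forall e, (0 < e)%N -> (h e <= B)%N) ->
  exists e0, forall e, (e0 <= e)%N -> h e = h e0.
Proof.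
move=> hm hB.
have mono e e' : (0 < e)%N -> (e <= e')%N -> (h e <= h e')%N.
  move=> e0 /subnKC <-; elim: (e' - e)%N => [|k IH]; first by rewrite addn0.
  by rewrite addnS; apply: leq_trans IH (hm _ _); rewrite addn_gt0 e0.
suff H n e1 : (0 < e1)%N -> (B - h e1 <= n)%N -> exists e0, forall e, (e0 <= e)%N -> h e = h e0.
  by apply: (H (B - h 1%N)%N 1%N).
elim: n e1 => [|n IH] e1 e1p Hn.
  exists e1 => e le; have e0 := leq_trans e1p le.
  by have := mono _ _ e1p le; have := hB _ e0; lia.
case: (classic (exists2 e, (e1 <= e)%N & (h e1 < h e)%N)) => [[e le lt]|Hno].
  by apply: (IH e); [apply: leq_trans le|lia].
exists e1 => e le; apply/eqP; rewrite eqn_leq (mono e1 e) // andbT leqNgt.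
by apply/negP => lt; apply: Hno; exists e.
Qed.

Lemma pihomog_mul (K : fieldType) n (h f : {mpoly K[n]}) k e : h \is k.-homog ->
  pihomog mdeg (k + e) (h * f) = h * pihomog mdeg e f.
Proof.
move=> hh; rewrite {1}(pihomog_partitionE (mf := mdeg) (leqnn (msize f))) mulr_sumr raddf_sum.
have E i : pihomog mdeg (k + e) (h * pihomog mdeg i f) = if i == e then h * pihomog mdeg e f else 0.
  have hi : h * pihomog mdeg i f \is (k + i).-homog by apply: dhomogM => //; apply: pihomogP.
  have [<-|ne] := eqVneq i e; first by rewrite pihomog_dE.
  by rewrite (pihomog_ne0 _ hi) // eqn_add2l.
rewrite (eq_bigr (fun i : 'I_(msize f) => if i == e :> nat then h * pihomog mdeg e f else 0)); last first.
  by move=> i _; rewrite /= E.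
have [lt|le] := ltnP e (msize f).
  rewrite (bigD1 (Ordinal lt)) //= eqxx big1 ?addr0 // => i.
  by rewrite -val_eqE /= => /negPf ->.
rewrite big1 => [|i _]; last by rewrite ltn_eqF // (leq_trans (ltn_ord i)).
suff -> : pihomog mdeg e f = 0 by rewrite mulr0.
rewrite pihomogE big_seq_cond big1 // => mn /andP[mnf /eqP dmn].
by have := msize_mdeg_lt mnf; rewrite dmn ltnNge le.
Qed.

(** * Nondegeneracy from minimality *)

Section Enlarge.
Variables (K : fieldType) (m : nat) (Z : subscheme K m).
Local Notation T := {mpoly K[m.+1]}.
Let I := sideal Z.
Let iI : ideal I := sideal_ideal Z.
Variables (t a : T).
Hypothesis ht : t \is 1.-homog.
Hypothesis ha : a \is 1.-homog.

(** The saturation of [I + (a)] with respect to [t]; when [t] has no zero on the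
    support of the scheme this is the saturated ideal of the subscheme cut out
    by [a]. *)
Definition enlarged (f : T) := exists k g, I (t ^+ k * f - a * g).

Lemma enlarged_ideal : ideal enlarged.
Proof.
have [I0 ID IM] := iI; split.
- by exists 0%N, 0; rewrite !mulr0 subrr.
- move=> f f' [k [g Ig]] [k' [g' Ig']]; exists (k + k')%N, (t ^+ k' * g + t ^+ k * g').
  have -> : t ^+ (k + k') * (f + f') - a * (t ^+ k' * g + t ^+ k * g') =
    t ^+ k' * (t ^+ k * f - a * g) + t ^+ k * (t ^+ k' * f' - a * g') by rewrite exprD; ring.
  by apply: ID; apply: IM.
- move=> f f' [k [g Ig]]; exists k, (f * g).
  have -> : t ^+ k * (f * f') - a * (f * g) = f * (t ^+ k * f' - a * g) by ring.
  exact: IM.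
Qed.

Lemma enlarged_homog_witness f e : enlarged f ->
  exists k g, g \is (k + e).-homog /\ I (t ^+ k.+1 * pihomog mdeg e f - a * g).
Proof.
case=> k [g Ig]; exists k, (pihomog mdeg (k + e) (t * g)); split; first exact: pihomogP.
have := @sideal_homog _ _ Z (t ^+ k.+1 * f - a * (t * g)); rewrite -/I => H.
have := H _ (k.+1 + e)%N; rewrite linearB /= (pihomog_mul _ _ (homog_exp k.+1 ht)).
have -> : pihomog mdeg (k.+1 + e) (a * (t * g)) = a * pihomog mdeg (k + e) (t * g).
  exact: (pihomog_mul _ _ ha).
apply.
have -> : t ^+ k.+1 * f - a * (t * g) = t * (t ^+ k * f - a * g) by rewrite exprS; ring.
by have [_ _ IM] := iI; apply: IM.
Qed.

Lemma enlarged_homog f : enlarged f -> forall e, enlarged (pihomog mdeg e f).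
Proof. by move=> If e; have [k [g [_ H]]] := enlarged_homog_witness e If; exists k.+1, g. Qed.

Lemma enlarged_reg k f : enlarged (t ^+ k * f) -> enlarged f.
Proof. by case=> k' [g H]; exists (k' + k)%N, g; rewrite exprD -mulrA. Qed.

Lemma enlarged_sat f k :
  (forall mon : 'X_{1..m.+1}, mdeg mon = k -> enlarged ('X_[mon] * f)) -> enlarged f.
Proof.
move=> H; apply: (@enlarged_reg k); have /dhomogP hk := homog_exp k ht.
rewrite (mpolyE (t ^+ k)) mulr_suml big_seq.
have [I0 ID IM] := enlarged_ideal.
apply: (big_ind enlarged) => // mn mnt; rewrite -scalerAl.
by apply: (ideal_scale _ enlarged_ideal); apply: H; apply: hk.
Qed.

Lemma enlarged0 : enlarged 0. Proof. by case: enlarged_ideal. Qed.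
Lemma enlargedD f g : enlarged f -> enlarged g -> enlarged (f + g).
Proof. by case: enlarged_ideal => _ H _; apply: H. Qed.
Lemma enlargedM f g : enlarged g -> enlarged (f * g).
Proof. by case: enlarged_ideal => _ _ H; apply: H. Qed.

Definition enlarged_scheme : subscheme K m :=
  Subscheme enlarged0 enlargedD enlargedM enlarged_homog enlarged_sat.

Lemma enlarged_sub f : I f -> enlarged f.
Proof. by exists 0%N, 0; rewrite expr0 mul1r mulr0 subr0. Qed.

Lemma enlarged_a : enlarged a.
Proof. by exists 0%N, 1; rewrite expr0 mul1r mulr1 subrr; case: iI. Qed.

Lemma graded_dim_le_succ (J : T -> Prop) e k k' : (forall f, J (t * f) -> J f) ->
  graded_coords J e k -> graded_coords J e.+1 k' -> (k <= k')%N.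
Proof.
move=> reg H H'; have [||//] := @graded_dim_le K m J J e e.+1 k k' (mulby t) H H'.
- by move=> f hf; exact: (dhomogM ht hf).
- by move=> f _ /reg.
Qed.

End Enlarge.

(** Strict inclusion in degree [e] makes the Hilbert function drop. *)
Lemma hilbert_lt (K : fieldType) m (Z Z' : subscheme K m) e k k' f :
  hilbert_fun Z e k -> hilbert_fun Z' e k' -> (forall g, sideal Z g -> sideal Z' g) ->
  f \is e.-homog -> sideal Z' f -> ~ sideal Z f -> (k' < k)%N.
Proof.
move=> [U [HU dU]] [U' [HU' dU']] ZZ' hf Z'f nZf.
have UU' : (U <= U')%VS by apply/subvP => g /HU /ZZ' /HU'.
have [E|ne] := eqVneq U U'.
  by case: nZf; apply: (HU (DHomog hf)).1; rewrite E; apply/HU'.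
have : (\dim U < \dim U')%N by rewrite ltn_neqAle dimvS // andbT dimv_leqif_eq.
by move: dU dU'; move: (\dim U) (\dim U') (\dim _) => x y z; lia.
Qed.

Section Nondeg.
Variables (K : closedFieldType) (m d : nat) (P : pspace K (vdim m d)) (Z : subscheme K m).
Local Notation T := {mpoly K[m.+1]}.
Let I := sideal Z.
Let iI : ideal I := sideal_ideal Z.
Variables (t : T) (q : nat) (y : 'rV[K]_m.+1).
Hypothesis ht : t \is 1.-homog.
Hypothesis reg : forall f, I (t * f) -> I f.
Hypothesis HF : forall e, (0 < e)%N -> graded_coords I e q.
Hypothesis HP : in_veronese_scheme_span Z P.
Hypothesis minZ : forall Z' k, zero_dim_of_degree Z' k -> in_veronese_scheme_span Z' P ->
  (q <= k)%N.
Hypothesis d2 : (1 < d)%N.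
Hypothesis Hy : forall g, g \is d.-1.-homog -> eval_at P (lform y * g) = 0.

(** If [lform y] were not in [I], the scheme of the enlarged ideal [I + (lform y)]
    would have smaller degree and [P] in the span of its Veronese image.  Its
    degree is positive, as otherwise its ideal would be everything and
    [eval_at P] would be 0. *)
Lemma minimal_nondegenerate : I (lform y).
Proof.
apply: NNPP => nIa; set a := lform y in nIa.
have ha : a \is 1.-homog := lform_homog y.
pose Z' := enlarged_scheme Z ht ha.
have regT k f : I (t ^+ k * f) -> I f by apply: reg_exp.
have HP' : in_veronese_scheme_span Z' P.
  apply/in_scheme_spanP => f hf If.
  have [k [g [hg Ig]]] := enlarged_homog_witness ht ha d If.
  rewrite pihomog_dE // in Ig.
  have hg' : g \is (d.-1 + k.+1).-homog by rewrite addnS -addSn prednK 1?addnC // ltnW.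
  have d1 : (1 <= d.-1)%N by lia.
  have [g2 hg2 Ig2] := divide_t_exp ht reg (e0 := 1) HF d1 hg'.
  have hag2 : a * g2 \is d.-homog by rewrite -(prednK (ltnW d2)); exact: (dhomogM ha hg2).
  have I2 : I (f - a * g2).
    apply: (regT k.+1); have [_ ID IM] := iI.
    have -> : t ^+ k.+1 * (f - a * g2) =
      (t ^+ k.+1 * f - a * g) + (- a) * (t ^+ k.+1 * g2 - g) by ring.
    by apply: ID => //; apply: IM.
  have := (in_scheme_spanP P Z).1 HP _ (rpredB hf hag2) I2.
  by rewrite linearB /= -/(eval_at P) => /eqP; rewrite subr_eq0 => /eqP ->; apply: Hy.
have regZ' f : sideal Z' (t * f) -> sideal Z' f by rewrite -{1}[t]expr1; apply: enlarged_reg.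
have [h Hh] : exists h, forall e, hilbert_fun Z' e (h e).
  exists (fun e => proj1_sig (constructive_indefinite_description _ (hilbert_exists Z' e))).
  by move=> e; case: constructive_indefinite_description.
have coordsZ' e : graded_coords (sideal Z') e (h e) by apply: hilbert_graded_coords.
have hle e : (0 < e)%N -> (h e < q)%N.
  move=> e0; have [k Hk] := hilbert_exists Z e.
  rewrite (graded_dim_uniq (HF e0) (hilbert_graded_coords Hk)).
  apply: (hilbert_lt (f := t ^+ e.-1 * a) Hk (Hh e)).
  - by move=> g; apply: enlarged_sub.
  - by have := dhomogM (homog_exp e.-1 ht) ha; rewrite addn1 prednK.
  - by apply: enlargedM; apply: enlarged_a.
  - by move/regT.
have [e1 He1] : exists e1, forall e, (e1 <= e)%N -> h e = h e1.
  apply: (@bounded_nondecreasing_stable h q) => e e0; last exact/ltnW/hle.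
  exact: (graded_dim_le_succ ht regZ' (coordsZ' e) (coordsZ' e.+1)).
have E := He1 _ (leqnSn e1).
have [k0|k0] := posnP (h e1); last first.
  have : (q <= h e1)%N.
    by apply: (minZ (Z' := Z')) => //; split=> //; exists e1 => e /He1 <-.
  by rewrite -E leqNgt hle.
have := coordsZ' e1.+1; rewrite E k0 => -[c [ck _]].
have : enlarged Z t a (t ^+ e1.+1 * 1).
  by rewrite mulr1; apply/ck; [apply: homog_exp|apply: thinmx0].
move/enlarged_reg => I1.
have [f hf] := eval_at_neq0 P; case/eqP; apply: (in_scheme_spanP P Z').1 => //.
by rewrite -[f]mulr1; apply: enlargedM.
Qed.
End Nondeg.

(** * The rank in terms of the number of components *)

Lemma ev_sym (K : fieldType) m (u v : 'rV[K]_m.+1) : ev u v = ev v u.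
Proof. by rewrite !evE !lform_eval; apply: eq_bigr => i _; rewrite mulrC. Qed.

(** A vector orthogonal to [U] and to a complement of [U] is 0, which bounds the
    dimension of the orthogonal of [U]. *)
Lemma annihilator (K : fieldType) m (U : {vspace 'rV[K]_m.+1}) :
  exists H : {vspace 'rV[K]_m.+1}, (forall v, v \in H <-> forall y, y \in U -> ev v y = 0) /\
    (\dim H + \dim U <= m.+1)%N.
Proof.
have [|H HH] := @vspace_of_pred K _ (fun v => forall y, y \in U -> ev v y = 0).
  split=> [y _|a u v Hu Hv y yU]; first by rewrite ev_sym linear0.
  by rewrite ev_sym linearP /= ![ev y _]ev_sym Hu // Hv // scaler0 addr0.
exists H; split=> //; have [N [HN dN]] := common_kernel (vbasis (U^C)%VS).
have dim_full : \dim {:'rV[K]_m.+1} = m.+1 by rewrite dimvf /dim /= mul1n.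
have NH0 : (H :&: N = 0)%VS.
  apply/eqP; rewrite -subv0; apply/subvP => v; rewrite memv_cap memv0 => /andP[vH vN].
  suff Hv x : ev v x = 0.
    apply/eqP/rowP => i; have := Hv (delta_mx 0 i).
    by rewrite evE lform_delta mevalXU mxE.
  have : x \in (U + U^C)%VS by rewrite addv_complf memvf.
  case/memv_addP => u uU [c cC ->]; rewrite linearD /= (HH v).1 // add0r.
  rewrite (coord_vbasis cC) linear_sum big1 // => i _.
  by rewrite linearZ /= ev_sym (HN v) ?scaler0 // mem_nth // size_tuple.
have := dimvS (subvf (H + N)%VS); rewrite dimv_disjoint_sum // dim_full.
move: dN; rewrite size_tuple dimv_compl dim_full.
have := dimvS (subvf U); rewrite dim_full.
by move: (\dim H) (\dim U) (\dim N) => x y z; lia.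
Qed.

Lemma memv_bigcap_seq (K : fieldType) (vT : vectType K) (J : eqType) (l : seq J)
  (U : J -> {vspace vT}) v i : v \in (\bigcap_(j <- l) U j)%VS -> i \in l -> v \in U i.
Proof.
elim: l => [|j l IH] //; rewrite big_cons memv_cap => /andP[vj vl].
by rewrite inE => /predU1P[->|/(IH vl)].
Qed.

Lemma graded_dim_mono (K : fieldType) m (t : {mpoly K[m.+1]}) (J : {mpoly K[m.+1]} -> Prop)
  e e' k k' :
  t \is 1.-homog -> (forall f, J (t * f) -> J f) -> lin_closed J -> (e <= e')%N ->
  graded_coords J e k -> graded_coords J e' k' -> (k <= k')%N.
Proof.
move=> ht reg lJ /subnKC <-; elim: (e' - e)%N k' => [|j IH] k' H H'.
  by rewrite addn0 in H'; rewrite (graded_dim_uniq H H').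
have [k'' H''] := graded_coords_exists (e + j) lJ; rewrite addnS in H'.
apply: leq_trans (IH _ H H'') _; exact: (graded_dim_le_succ ht reg H'' H').
Qed.

Section Rank.
Variables (K : closedFieldType) (charK0 : [pchar K] =i pred0) (m d : nat).
Variables (hm : (4 <= m)%N) (hd : (4 <= d)%N) (P : pspace K (vdim m d)).
Local Notation T := {mpoly K[m.+1]}.
Hypothesis hH : ~ exists H : {vspace 'rV[K]_m.+1}, \dim H = 4%N /\
  in_span (veronese_image (fun p : pspace K m => (pline p <= H)%VS)) P.

(** The points of the decomposition given by [multi_waring] lie in the linear span
    of [A]; as they are not contained in a subspace of dimension 4, the linear
    forms in [I] have codimension at least 5.  The Hilbert function of [A] is
    nondecreasing in positive degrees, is at least 5 in degree 1, and is at
    most [\sum b_i = 5] in large degrees; so it is constant. *)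
Theorem rank_of_type s (b : seq nat) : sumn b = 5%N ->
  has_type P s b -> rank_is P (5 + (5 - s) * (d - 2))%N.
Proof.
move=> sum_b [A [HP [k [_ minA] [k0 [e1 HA]]]] [sb _ [A_ [conn _ inter] zdA]]].
pose bi (i : 'I_s) := nth 0%N b i.
have bi0 i : (0 < bi i)%N by case: (zdA i).
have sum_bi : (\sum_i bi i = 5)%N.
  by rewrite -sum_b sumnE (big_nth 0%N) big_mkord sb.
have bi5 i : (bi i <= 5)%N by rewrite -sum_bi (bigD1 i) //= leq_addr.
have [i|e_ He] := @fin_choice s nat (fun i e0 => forall e, (e0 <= e)%N -> hilbert_fun (A_ i) e (bi i)).
  by case: (zdA i).
have HFi i e : (e_ i <= e)%N -> graded_coords (sideal (A_ i)) e (bi i)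
   by move=> le; apply/hilbert_graded_coords/He.
have [i|v_ Hv] := @fin_choice s 'rV[K]_m.+1 (fun i v => v != 0 /\
    forall p, supp (A_ i) p <-> pline p = <[v]>%VS).
  by apply: (connected_point (HFi i _ (leq_maxl _ (bi i)))) => //; apply: leq_maxr.
have v0 i : v_ i != 0 by case: (Hv i).
have sv i p : supp (A_ i) p <-> pline p = <[v_ i]>%VS by case: (Hv i).
pose I := sideal A; have iI : ideal I := sideal_ideal A.
have HPf := (in_scheme_spanP P A).1 HP.
have [|cv [scv zcv Ecv]] := @multi_waring K charK0 m d hd s A_ v_ bi e_
   v0 sv bi5 HFi (enum 'I_s) (eval_at P).
  move=> f hf Hf; apply: HPf => //; apply/inter => i; apply: Hf; exact: mem_enum.
have [|S [sS HS pS]] := @points_of_vectors K m d cv; first by rewrite (leq_trans _ hd).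
have spanS : in_veronese_span S P.
  apply/in_spanP => f hf /(HS f hf) fcv; rewrite Ecv // big_seq big1 // => a acv.
  by rewrite fcv ?mulr0.
(* Each component contributes [(b_i - 1) (d - 1) + 1] points, and the [b_i - 1] add
   up to [5 - s]. *)
have bound : (#|` S| <= 5 + (5 - s) * (d - 2))%N.
  apply: leq_trans sS (leq_trans scv _); rewrite big_enum /=.
  have E : (\sum_i (bi i).-1 + s = 5)%N.
    rewrite -sum_bi -[X in (_ + X)%N = _](card_ord s) -sum1_card -big_split;
       apply: eq_bigr => i _ /=.
    by rewrite addn1 prednK.
  under eq_bigr do rewrite -addn1.
  rewrite big_split /= -big_distrl /= sum1_card card_ord.
  by move: E; move: (\sum_i _)%N => x; nia.
have [|U1 HU1] := @vspace_of_pred K _ (fun y => I (lform y)).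
  split=> [|a u v Iu Iv]; first by rewrite linear0; case: iI.
  by rewrite lform_linear; apply: (ideal_lin iI).2.
have dU1 : (\dim U1 + 5 <= m.+1)%N.
  have [H0 [HH0 dH0]] := annihilator U1; rewrite leqNgt; apply/negP => big.
  have [|H H0H dH] := @vspace_extend K _ H0 4.
    rewrite dimvf /dim /= mul1n; move: dH0 big; move: (\dim H0) (\dim U1) => x y; lia.
  apply: hH; exists H; split=> // W HW; apply: spanS => q [p pSS ->].
  apply: HW; exists p => //; have [a acv ->] := pS p pSS.
  apply: subv_trans H0H; rewrite -memvE; apply/HH0 => y /HU1 Iy.
  by rewrite evE zcv // => i _; apply: (inter _).1.
pose vs := [seq v_ i | i <- enum 'I_s].
have svs : size vs = s by rewrite size_map size_enum_ord.
have reg y f : (forall v, v \in vs -> ev v y != 0) -> I (lform y * f) -> I f.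
  move=> Hy /inter If; apply/inter => i.
  apply: (nonvanishing_regular (HFi i _ (leq_maxl _ (bi i))) (leq_maxr _ _) _ (If i)) => p /sv Ep.
  have vp : v_ i \in pline p by rewrite Ep memv_line.
  have := Hy (v_ i); rewrite evE => /(_ (map_f _ (mem_enum _ _))) /eqP ne /(_ _ vp).
  exact: ne.
have [|y0 Hy0] := nonvanishing_form charK0 (l := vs).
  by move=> _ /mapP[i _ ->].
have ht := lform_homog y0; have regt f : I (lform y0 * f) -> I f by apply: reg.
have HA' e : (e1 <= e)%N -> graded_coords I e k by move=> le; apply/hilbert_graded_coords/HA.
have k5 : (k <= 5)%N.
  pose e := maxn e1 (\max_i e_ i).
  have [U [HU dU]] := HA e (leq_maxl _ _).
  have [i|Ui HUi] := @fin_choice s {vspace dhomog m.+1 K e} (fun i U =>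
      (forall f, f \in U <-> sideal (A_ i) (mpoly_of_dhomog f)) /\
      (\dim U + bi i = \dim {:dhomog m.+1 K e})%N).
    apply: (He i); apply: leq_trans (leq_maxr _ _); exact: leq_bigmax.
  have := @codim_bigcap K _ _ (enum 'I_s) Ui bi (fun i _ => (HUi i).2).
  have sub : (\bigcap_(i <- enum 'I_s) Ui i <= U)%VS.
    apply/subvP => f fI; apply/HU/inter => i; apply/(HUi i).1.
    by apply: memv_bigcap_seq fI _; rewrite mem_enum.
  have := dimvS sub; rewrite [X in (_ <= _ + X)%N]big_enum /= sum_bi -dU.
  by move: (\dim _) (\dim _) => x y; lia.
have HF e : (0 < e)%N -> graded_coords I e 5.
  move=> e0; have [q Hq] := graded_coords_exists e (ideal_lin iI).
  have [q1 Hq1] := graded_coords_exists 1 (ideal_lin iI).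
  have le1 := graded_dim_mono ht regt (ideal_lin iI) e0 Hq1 Hq.
  have le2 := graded_dim_mono ht regt (ideal_lin iI) (leq_maxl e e1) Hq (HA' _ (leq_maxr e e1)).
  have q15 : (5 <= q1)%N.
    have [c [ck _]] := Hq1.
    have clin : linear (fun y => c (lform y)) by move=> a u v; rewrite lform_linear linearP.
    pose F := linfun (mk_linear clin).
    have KU : (lker F <= U1)%VS.
      apply/subvP => y; rewrite memv_ker lfunE /= => /eqP cy; apply/HU1.
      by apply/ck => //; apply: lform_homog.
    have := limg_ker_dim F fullv; rewrite capfv dimvf /dim /= mul1n => E.
    have := dimvS (subvf (F @: fullv)); rewrite dimvf /dim /= mul1n.
    move: (dimvS KU) dU1 E; move: (\dim _) (\dim _) (\dim _) => x1 x2 x3; lia.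
  have -> : 5%N = q by lia.
  exact: Hq.
have Ek : k = 5%N := graded_dim_uniq (HA' (maxn e1 1) (leq_maxl _ _)) (HF _ (leq_maxr _ _)).
have nd y : (forall g, g \is d.-1.-homog -> eval_at P (lform y * g) = 0) -> I (lform y).
  apply: (minimal_nondegenerate ht regt HF HP).
    by move=> Z' k' HZ' HPZ'; rewrite -Ek; apply: minA HPZ'.
  by rewrite (leq_trans _ hd).
have lower (S' : {fset pspace K m}) : in_veronese_span S' P -> (5 + (5 - s) * (d - 2) <= #|` S'|)%N.
  move=> /in_spanP HS'; rewrite -svs.
  have [n En] : exists n, d = n.+2 by exists (d - 2)%N; lia.
  have -> : #|` S'| = size [seq vpick (pline p) | p <- enum_fset S'] by rewrite size_map.
  rewrite (_ : d - 2 = n)%N; last by rewrite En subSS subSS subn0.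
  apply: (rank_lower_bound reg HF HU1 dU1 Hy0 (L := eval_at P)).
  - by rewrite -En.
  - by move=> y; rewrite -[n.+1]/(n.+2.-1) -En; apply: nd.
  - rewrite -En => f hf Hf; apply: HS' => // p pS'.
    apply/(vanishes_homog hf (memv_pick _) (pline_pick p)); apply: Hf.
    by apply: map_f.
split=> //; exists S; split=> //.
by apply/eqP; rewrite eqn_leq bound lower.
Qed.
End Rank.

Theorem theorem1 (K : closedFieldType) (charK0 : [pchar K] =i pred0)
    (m d : nat) (hm : (4 <= m)%N) (hd : (9 <= d)%N)
    (P : pspace K (vdim m d))
    (hborder : border_rank_is P 5)
    (hH : ~ exists H : {vspace 'rV[K]_m.+1},
        \dim H = 4%N /\
        in_span (veronese_image (fun p : pspace K m => (pline p <= H)%VS)) P) :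
  (has_type P 1 [:: 5]%N -> rank_is P (4 * d - 3)%N) /\
  (has_type P 2 [:: 3; 2]%N -> rank_is P (3 * d - 1)%N) /\
  (has_type P 2 [:: 4; 1]%N -> rank_is P (3 * d - 1)%N) /\
  (has_type P 3 [:: 3; 1; 1]%N -> rank_is P (2 * d + 1)%N) /\
  (has_type P 3 [:: 2; 2; 1]%N -> rank_is P (2 * d + 1)%N) /\
  (has_type P 4 [:: 2; 1; 1; 1]%N -> rank_is P (d + 3)%N) /\
  (has_type P 5 [:: 1; 1; 1; 1; 1]%N -> rank_is P 5).
Proof.
have hd4 : (4 <= d)%N by apply: leq_trans hd.
have rank s b k : sumn b = 5%N -> k = (5 + (5 - s) * (d - 2))%N ->
    has_type P s b -> rank_is P k.
  by move=> sum_b -> /(rank_of_type charK0 hm hd4 hH sum_b).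
do 6!(split; first by apply: rank => //; lia).
by apply: rank.
Qed.
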